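(* For every $\omega\in S_{n+1}$, \begin{align*} \mathfrak{G}_{\omega}(x,y)&=\sum_{\mathfrak{f}\in \mathfrak{F}^{\circ}_{\omega}} x^{\mathrm{xwt}(\mathfrak{f})}y^{\mathrm{ywt}(\mathfrak{f})},\\ \mathfrak{G}_{\omega}(x,y)&=\sum_{\mathfrak{f}\in \mathfrak{F}^{\square}_{\omega}} x^{\mathrm{xwt}(\mathfrak{f})}y^{\mathrm{ywt}(\mathfrak{f})},\\ \mathfrak{G}_{\omega}(x,y)&=\sum_{(u,v)\in X_{\omega}} \mathfrak{G}_{u^{-1}}(y)\,\mathfrak{G}_{v}(x). \end{align*}
   Context: Let $x=(x_1,\dots,x_{n+1})$, $y=(y_1,\dots,y_{n+1})$. For $f\in\mathbb{Z}[x,y]$ and $1\le i\le n$ let $\delta_i f=\frac{f-s_if}{x_i-x_{i+1}}$ ($s_i$ swaps $x_i,x_{i+1}$, acting $\mathbb{Z}[y]$-linearly) and $\pi_i f=\delta_i f+\delta_i(x_{i+1}f)$; for a permutation with reduced word $s_{i_1}\cdots s_{i_\ell}$ set $\pi_{\sigma}=\pi_{i_1}\cdots\pi_{i_\ell}$ (well defined). Let $\omega_0$ be the longest element of $S_{n+1}$. The single Grothendieck polynomial is $\mathfrak{G}_{\omega}(x)=\pi_{\omega^{-1}\omega_0}(x_1^{n}x_2^{n-1}\cdots x_n^1)$ and the double Grothendieck polynomial is $\mathfrak{G}_{\omega}(x,y)=\pi_{\omega^{-1}\omega_0}\big(\prod_{i+j\le n+1}(x_i+y_j+x_iy_j)\big)$.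 For $1\le i\le n$, the operator $\bar s_i$ acts on arrangements of $\{1,\dots,n+1\}$ by interchanging $i$ and $i+1$ if $i$ lies to the left of $i+1$, and doing nothing otherwise. A Hecke word (written as a word in $1,\dots,n$, letter $i$ standing for $\bar s_i$) represents $\omega$ if applying the operators right to left to $(1,2,\dots,n+1)$ yields $\omega$. $X_\omega$ is the set of pairs of permutations $(u,v)$ such that the concatenation of a Hecke word for $u$ with a Hecke word for $v$ represents $\omega$. Write $i^{\circ}$ for a ''circled'' letter $i$. A bounded circled Hecke factorization of $\omega$ is a sequence of $n+1$ factors whose letters are drawn from $\{1^{\circ},1,2^{\circ},2,\dots,n^{\circ},n\}$ such that: erasing circles and parentheses gives a Hecke word for $\omega$; each factor is strictly decreasing in the order $1^{\circ}<1<2^{\circ}<2<\cdots<n^{\circ}<n$; every element in the $i$-th factor is $\ge i^{\circ}$. $\mathfrak{F}^{\circ}_\omega$ is the set of these. Its $x$-weight has $i$-th entry the number of uncircled letters in the $i$-th factor; its $y$-weight has $i$-th entry the number of circled letters $j^{\circ}$ lying in a factor $k$ with $j-k+1=i$. A bounded double Hecke factorization of $\omega$ is a sequence of $2n+2$ factors (letters in $\{1,\dots,n\}$) whose concatenation is a Hecke word for $\omega$, where the first $n+1$ factors (left of center) are strictly increasing and the last $n+1$ factors (right of center) are strictly decreasing, and where every element of the $i$-th factor to the right of center, and of the $i$-th factor to the left of center (counting outward from the center), is $\ge i$. $\mathfrak{F}^{\square}_\omega$ is the set of these. Its $x$-weight has $i$-th entry the number of letters in the $i$-th factor to the right of center;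 its $y$-weight has $i$-th entry the number of letters in the $i$-th factor to the left of center. *)

(* Defs.v *)
From HB Require Import structures.
From mathcomp Require Import all_boot all_order all_fingroup all_algebra.
From mathcomp Require Import mpoly.
From mathcomp Require boolp.

Set Implicit Arguments.
Unset Strict Implicit.
Unset Printing Implicit Defensive.

Import GRing.Theory.
Local Open Scope ring_scope.

(* Indices start at 0 throughout: i : 'I_n is the letter i + 1, the variable  *)
(* x_(i+1) is 'X_(xvar i), and k : 'I_n.+1 is the value or position k + 1.    *)

Section Words.
Variable n : nat.
Implicit Types (i : 'I_n) (w : seq 'I_n) (s t : 'S_n.+1).

Definition lo i : 'I_n.+1 := widen_ord (leqnSn n) i.
Definition hi i : 'I_n.+1 := lift ord0 i.

(* A permutation s is the arrangement (s 0, ..., s n). Products of            *)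
(* permutations compose from left to right: (s * t) p = t (s p). So the       *)
(* permutation s_(i_1) o ... o s_(i_l), obtained by exchanging values right   *)
(* to left, is tperm_(i_l) * ... * tperm_(i_1).                               *)
Definition word_perm w : 'S_n.+1 :=
  foldr (fun i s => s * tperm (lo i) (hi i))%g 1%g w.

Definition reduced w : bool :=
  [forall k : 'I_(size w), forall w' : k.-tuple 'I_n,
     word_perm w' != word_perm w].

Definition hecke_op i s : 'S_n.+1 :=
  if ((s^-1)%g (lo i) < (s^-1)%g (hi i))%N then (s * tperm (lo i) (hi i))%g
  else s.

Definition represents w s : bool := foldr hecke_op 1%g w == s.

(* The longest element, k |-> n - k. *)
Definition w0 : 'S_n.+1 := perm rev_ord_inj.

Lemma word_perm_cat w w' :
  word_perm (w ++ w') = (word_perm w' * word_perm w)%g.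
Proof.
by elim: w => [|i w IHw] /=; rewrite ?mulg1 // IHw mulgA.
Qed.

Lemma tperm_word d (a b : 'I_n.+1) :
  b = (a + d.+1)%N :> nat -> exists w, word_perm w = tperm a b.
Proof.
elim: d b => [|d IHd] b eq_b.
  have lt_an : (a < n)%N by rewrite -ltnS (leq_trans _ (ltn_ord b)) // eq_b addn1.
  exists [:: Ordinal lt_an]; rewrite /= mul1g; congr tperm; apply/val_inj => //=.
  by rewrite /bump /= add1n eq_b addn1.
have lt_cn : (a + d.+1 < n)%N by rewrite -ltnS -addnS -eq_b.
pose i := Ordinal lt_cn; have [w Dw] := IHd (lo i) (erefl _).
have Db : hi i = b by apply/val_inj; rewrite /= /bump /= add1n eq_b -addnS.
exists ([:: i] ++ w ++ [:: i]); rewrite !word_perm_cat Dw /= mul1g Db.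
have -> : tperm a b = (tperm a (lo i) ^ tperm (lo i) b)%g.
  rewrite tpermJ tpermL tpermD // -val_eqE /= ?eq_b.
    by rewrite -{2}[nat_of_ord a]addn0 eqn_add2l.
  by rewrite -{2}[nat_of_ord a]addn0 eqn_add2l.
by rewrite /conjg tpermV mulgA.
Qed.

Lemma word_permP s : exists w, word_perm w = s.
Proof.
have [ts -> _] := prod_tpermP s; elim: ts => [|[a b] ts [w Dw]].
  by exists [::]; rewrite big_nil.
have [w' Dw'] : exists w', word_perm w' = tperm a b.
  have [lt_ab|lt_ba|/val_inj->] := ltngtP a b.
  - by apply: (@tperm_word (b - a).-1); rewrite prednK ?subn_gt0 ?subnKC // ltnW.
  - rewrite tpermC; apply: (@tperm_word (a - b).-1).
    by rewrite prednK ?subn_gt0 ?subnKC // ltnW.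
  - by exists [::]; rewrite tperm1.
by exists (w ++ w'); rewrite word_perm_cat big_cons Dw Dw'.
Qed.

Lemma reduced_wordP s : exists w, (word_perm w == s) && reduced w.
Proof.
pose P k := [exists w : k.-tuple 'I_n, word_perm w == s].
have exP : exists k, P k.
  have [w Dw] := word_permP s.
  by exists (size w); apply/existsP; exists (in_tuple w); apply/eqP.
case: (ex_minnP exP) => k /existsP[w /eqP Dw] min_k.
exists w; rewrite Dw eqxx /=; apply/forallP => j; apply/forallP => w'.
apply: contraTneq (ltn_ord j) => Dw'; rewrite -leqNgt (leq_trans _ (min_k _ _)) //.
  by rewrite size_tuple.
by apply/existsP; exists w'; rewrite Dw' Dw.
Qed.

Definition reduced_word s : seq 'I_n := xchoose (reduced_wordP s).

Definition hecke_pairs s : {set 'S_n.+1 * 'S_n.+1} :=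
  [set uv | boolp.asbool (exists a b : seq 'I_n,
     [/\ represents a uv.1, represents b uv.2 & represents (a ++ b) s])].

End Words.

Section Polynomials.
Variable n : nat.
Local Notation polyxy := {mpoly int[n.+1 + n.+1]}.
Implicit Types (i : 'I_n) (f g : polyxy) (s : 'S_n.+1).

Definition xvar (k : 'I_n.+1) : 'I_(n.+1 + n.+1) := lshift n.+1 k.
Definition yvar (k : 'I_n.+1) : 'I_(n.+1 + n.+1) := rshift n.+1 k.

Definition swapx i f : polyxy := msym (tperm (xvar (lo i)) (xvar (hi i))) f.

Lemma divdiffP i f :
  exists g, g * ('X_(xvar (lo i)) - 'X_(xvar (hi i))) == f - swapx i f.
Proof.
rewrite /swapx; set a := xvar (lo i); set b := xvar (hi i).
elim/mpolyind: f => [|c m f _ _ [g /eqP Dg]].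
  by exists 0; rewrite mul0r msym0 subr0.
suff [h Dh] : exists h : polyxy,
    h * ('X_a - 'X_b) = 'X_[m] - msym (tperm a b) 'X_[m].
  exists (c *: h + g); rewrite mulrDl Dg -scalerAl Dh msymD msymZ.
  by rewrite scalerBr opprD addrACA.
have dvdM p q : (exists h : polyxy, h * ('X_a - 'X_b) = p - msym (tperm a b) p) ->
    (exists h : polyxy, h * ('X_a - 'X_b) = q - msym (tperm a b) q) ->
  exists h : polyxy, h * ('X_a - 'X_b) = p * q - msym (tperm a b) (p * q).
  move=> [h Dh] [k Dk]; exists (h * q + msym (tperm a b) p * k).
  by rewrite msymM mulrDl mulrAC Dh -mulrA Dk mulrBl mulrBr addrA subrK.
have dvd1 : exists h : polyxy, h * ('X_a - 'X_b) = 1 - msym (tperm a b) 1.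
  by exists 0; rewrite mul0r rmorph1 subrr.
rewrite (mpolyXE_id _ m); elim/big_ind: _ => // j _.
elim: (m j) => [|e IHe]; first by rewrite expr0.
rewrite exprS; apply: dvdM IHe.
have Dj : msym (tperm a b) 'X_j = 'X_(tperm a b j) :> polyxy.
  by rewrite /msym mmapX mmap1U.
rewrite Dj; case: tpermP => [->|->|_ _].
- by exists 1; rewrite mul1r.
- by exists (-1); rewrite mulN1r opprB.
- by exists 0; rewrite mul0r subrr.
Qed.

(* The quotient is unique because the polynomial ring is a domain.            *)
Definition divdiff i f : polyxy := xchoose (divdiffP i f).

Definition isobaric i f : polyxy :=
  divdiff i f + divdiff i ('X_(xvar (hi i)) * f).

(* The choice of the reduced word is immaterial: the operators isobaric i     *)
(* satisfy the braid relations.                                               *)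
Definition isobaric_perm s f : polyxy := foldr isobaric f (reduced_word s).

(* The composite s^-1 o w0 of functions is the product w0 * s^-1.             *)
Definition single_groth s : polyxy :=
  isobaric_perm (w0 n * s^-1)%g
    (\prod_(k < n.+1) 'X_(xvar k) ^+ (n - k)).

Definition double_groth s : polyxy :=
  isobaric_perm (w0 n * s^-1)%g
    (\prod_(k < n.+1) \prod_(l < n.+1 | (k.+1 + l.+1 <= n.+1)%N)
       ('X_(xvar k) + 'X_(yvar l) + 'X_(xvar k) * 'X_(yvar l))).

Definition x_to_y f : polyxy :=
  f \mPo [tuple match split k with
                | inl l => 'X_(yvar l)
                | inr l => 'X_(yvar l)
                end | k < n.+1 + n.+1].

Definition xymonomial (a b : 'I_n.+1 -> nat) : polyxy :=
  (\prod_(k < n.+1) 'X_(xvar k) ^+ a k) * (\prod_(k < n.+1) 'X_(yvar k) ^+ b k).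

End Polynomials.

Section Factorizations.
Variable n : nat.

(* (j, true) is the circled letter and (j, false) the uncircled one.          *)
Definition cletter := ('I_n * bool)%type.

(* Position of a letter in the order 0^o < 0 < 1^o < 1 < ...                  *)
Definition crank (j : nat) (circled : bool) : nat := (j.*2 + ~~ circled)%N.

(* The bound on the length of a factor only makes the type finite: a strictly *)
(* decreasing word in 2 n letters has length at most 2 n, and similarly below.*)
Definition cfactorization := n.+1.-tuple (n.*2.-bseq cletter).

Definition bounded_circled (s : 'S_n.+1) : {set cfactorization} :=
  [set f : cfactorization |
    [&& represents [seq a.1 | a <- flatten [seq val h | h <- f]] s,
        [forall k, sorted (fun a b : cletter => crank b.1 b.2 < crank a.1 a.2)%N
                          (tnth f k)]
      & [forall k : 'I_n.+1,
           all (fun a : cletter => crank k true <= crank a.1 a.2)%N (tnth f k)]]].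

Definition cxwt (f : cfactorization) (i : 'I_n.+1) : nat :=
  count (fun a : cletter => ~~ a.2) (tnth f i).

(* With indices from 0 the condition j - k + 1 = i reads j = i + k.           *)
Definition cywt (f : cfactorization) (i : 'I_n.+1) : nat :=
  (\sum_(k < n.+1)
     count (fun a : cletter => a.2 && (a.1 == i + k :> nat)) (tnth f k))%N.

(* The factors from left to right; the center is between the first n + 1 and  *)
(* the last n + 1.                                                            *)
Definition dfactorization := (n.+1 + n.+1).-tuple (n.-bseq 'I_n).

Definition right_factor (f : dfactorization) (k : 'I_n.+1) : seq 'I_n :=
  tnth f (rshift n.+1 k).
Definition left_factor (f : dfactorization) (k : 'I_n.+1) : seq 'I_n :=
  tnth f (lshift n.+1 (rev_ord k)).

Definition bounded_double (s : 'S_n.+1) : {set dfactorization} :=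
  [set f : dfactorization |
    [&& represents (flatten [seq val h | h <- f]) s,
        [forall k, sorted (fun a b : 'I_n => a < b)%N (left_factor f k)],
        [forall k, sorted (fun a b : 'I_n => b < a)%N (right_factor f k)]
      & [forall k : 'I_n.+1, all (fun a : 'I_n => k <= a)%N (left_factor f k)
                          && all (fun a : 'I_n => k <= a)%N (right_factor f k)]]].

Definition dxwt (f : dfactorization) (i : 'I_n.+1) : nat :=
  size (right_factor f i).
Definition dywt (f : dfactorization) (i : 'I_n.+1) : nat :=
  size (left_factor f i).

End Factorizations.

(* Main.v *)
Require Import Defs.
From HB Require Import structures.
From mathcomp Require Import all_boot all_order all_fingroup all_algebra.
From mathcomp Require Import ssrAC zify ring mpoly.
Local Open Scope ring_scope.

Set Implicit Arguments.
Unset Strict Implicit.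
Unset Printing Implicit Defensive.
Import GRing.Theory.

(* Following Fomin and Kirillov, let u_1, ..., u_n generate the algebra of the  *)
(* 0-Hecke monoid, h_i(x) = 1 + x u_i, A_k(x) = h_n(x) ... h_k(x) and           *)
(* B_k(y) = h_k(y) ... h_n(y). Put                                              *)
(*   G(x, y) = B_n(y_n) ... B_1(y_1) A_1(x_1) ... A_n(x_n).                     *)
(* The Yang-Baxter equation gives G h_i(x_(i+1)) = (s_i G) h_i(x_i), which says *)
(* that pi_i sends the coefficient of w in G to that of w s_i whenever          *)
(* w s_i < w. The same equation moves the factors B to the right, where they    *)
(* disappear:                                                                   *)
(*   G(x, y) = \prod_(k = 1, ..., n) \prod_(j = n, ..., k) h_j(x_k (+) y_(j-k+1)) *)
(* with x (+) y = x + y + x y.                                                  *)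
(* In this form G has l(w0) factors, so the coefficient of w0 is the product of *)
(* all parameters. Hence the coefficient of w is the double Grothendieck        *)
(* polynomial of w, and the single one for y = 0. Expanding the second form     *)
(* yields circled factorizations, expanding the first yields double             *)
(* factorizations, and splitting the first at its center yields the pairs.      *)

(** * The Yang-Baxter equation *)

(** Everything rests on identifying [double_groth w] with the coefficient of [w] in one element,
    [groth_gen], of the 0-Hecke algebra ([double_grothE]). Two facts determine these coefficients:
    the one of [w0] is the product from which double Grothendieck polynomials start
    ([groth_gen_top]), and [isobaric i] removes a descent at [i] ([isobaric_groth_gen]). The first
    comes from [yang_baxter], which through [incprod_decprod] rewrites [groth_gen] with exactly as
    many factors as [w0] has inversions. The second comes from [hfac_exchange], which through
    [decprod_exchange] tells how [groth_gen] changes when two neighbouring x variables are swapped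
    ([groth_gen_swap]).

    Each formula reads the coefficient off another product form. [coef_prod_hfac] expands the mixed
    form ([mixprod_blocks]) into circled factorizations and the defining form ([groth_gen_blocks])
    into double factorizations. For the pairs, the coefficient of a product of two elements is a sum
    over pairs with a given 0-Hecke product, and these pairs are [hecke_pairs] ([hecke_pairsE]). *)

Section IdempotentBraid.
Variables (P : comNzRingType) (A : algType P).
Implicit Types (a b c x y : P) (p q u v : A).

Definition hfac x u : A := 1 + x *: u.

(** The multiplicative formal group law: [1 + oplus x y] is [(1 + x) * (1 + y)]. *)
Definition oplus x y := x + y + x * y.

Lemma hfacM u x y : u * u = u -> hfac x u * hfac y u = hfac (oplus x y) u.
Proof.
move=> uu; rewrite /hfac /oplus mulrDl mul1r mulrDr mulr1 -scalerAl -scalerAr.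
by rewrite uu scalerA !scalerDl !addrA (addrAC 1).
Qed.

Lemma hfac0 u : hfac 0 u = 1.
Proof. by rewrite /hfac scale0r addr0. Qed.

Lemma hfac_comm x u q : u * q = q * u -> hfac x u * q = q * hfac x u.
Proof. by move=> uq; rewrite /hfac mulrDl mulrDr mul1r mulr1 -scalerAl uq scalerAr. Qed.

Lemma hfac3 u v a b c : u * u = u ->
  hfac a u * hfac b v * hfac c u =
    1 + oplus a c *: u + b *: v + (a * b) *: (u * v) + (b * c) *: (v * u)
      + (a * b * c) *: (u * v * u).
Proof.
move=> uu; rewrite /hfac /oplus !(mulrDl, mulrDr, mulr1, mul1r).
rewrite -?(scalerAl, scalerAr) uu ?scalerA ?scalerDl.
by rewrite [LHS](AC ((2*2)*(2*2)) (1*(3*5*7)*2*4*6*8)).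
Qed.

(** In the normal form of [hfac3] both sides have the coefficient [oplus x y] at [u] and at [v],
    which dictates the middle parameter; the cubic terms agree by the braid relation. *)
Lemma yang_baxter u v x y : u * u = u -> v * v = v -> u * v * u = v * u * v ->
  hfac y u * hfac (oplus x y) v * hfac x u
  = hfac x v * hfac (oplus x y) u * hfac y v.
Proof.
move=> uu vv uvu; rewrite !hfac3 // uvu.
have -> : oplus y x = oplus x y by rewrite /oplus (addrC y) mulrC.
set z := oplus x y; rewrite (mulrC y z) (mulrC z x) (mulrAC z y x) (mulrC z x).
by rewrite [LHS](AC 6 (1*3*2*5*4*6)).
Qed.

(* If [1 + y] were invertible, then [p = q * hfac ((x - y) / (1 + y)) v] and   *)
(* this would be the Yang-Baxter equation.                                    *)
Lemma hfac_exchange p q u v x y :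
    u * u = u -> v * v = v -> u * v * u = v * u * v ->
    p * hfac y v = q * hfac x v ->
  p * (hfac x u * hfac y v * hfac y u) = q * (hfac y u * hfac x v * hfac x u).
Proof.
move=> uu vv uvu H.
(* The two outer terms depend on [r], [a], [b] only through [r * hfac b v] and [a * b], on which
   both sides agree. Only the coefficient of [u] is left to compare. *)
have E r a b : r * (hfac a u * hfac b v * hfac b u)
    = r * hfac b v + (oplus a b *: r + (b * b) *: (r * v)) * u
      + (a * b) *: (r * hfac b v * (u * v)).
  rewrite hfac3 // uvu /hfac !mulrDr !mulrDl mulr1 -!(scalerAl, scalerAr) scalerDr.
  by rewrite scalerA !mulrA [LHS](AC 6 (1*3*(2*5)*(4*6))).
rewrite !E H (mulrC y x); congr (_ + _ * _ + _).
move: H; rewrite /hfac !mulrDr !mulr1 -!scalerAr => H.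
have Hv : p * v + y *: (p * v) = q * v + x *: (q * v).
  by have := congr1 ( *%R^~ v) H; rewrite /= !mulrDl -!scalerAl -!mulrA vv.
(* Subtracting [Hv] from [H] gives [p - p * v = q - q * v]. *)
have Hpq : p + q * v = q + p * v.
  apply: (addIr (y *: (p * v) + x *: (q * v))).
  by rewrite addrACA H -Hv [RHS](AC (2*2) ((1*4)*(2*3))).
have D r a b : oplus a b *: r + (b * b) *: (r * v)
    = a *: r + (a * b) *: r + b *: (r + b *: (r * v)).
  by rewrite /oplus !scalerDl scalerDr scalerA [LHS](AC (3*1) (1*3*(2*4))).
rewrite !D [in LHS]H -[in RHS]H !(scalerDr y) !(scalerDr x) !scalerA.
rewrite (mulrC y x) [LHS](AC (2*2) ((1*3)*(2*4))) /= -(scalerDr (x * y)) Hpq scalerDr.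
by rewrite [RHS](AC (2*2) ((3*1)*(2*4))).
Qed.
End IdempotentBraid.

(** * Products of Hecke factors over the letters *)

Section HeckeGenerators.
Variables (P : comNzRingType) (A : algType P) (u : nat -> A).
Hypothesis u_idem : forall i, u i * u i = u i.
Hypothesis u_braid : forall i, u i * u i.+1 * u i = u i.+1 * u i * u i.+1.
Hypothesis u_comm : forall i j, (i.+1 < j)%N -> u i * u j = u j * u i.
Implicit Types (x y : P) (z : nat -> P) (d k m : nat).

Local Notation h k x := (hfac x (u k)).

(* With letters from 0 and n = k + d, [decfac d k] is A_(k+1) and [incfac d k]  *)
(* is B_(k+1), on the letters k, ..., k + d - 1; [incprod n 0] and             *)
(* [decprod n 0] are the products B_n ... B_1 and A_1 ... A_n, and             *)
(* [mixprod n 0] is the product of the h_j(x_k + y_(j-k+1) + x_k y_(j-k+1)).   *)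
Fixpoint decfac d k x : A :=
  if d is d'.+1 then decfac d' k.+1 x * h k x else 1.

Fixpoint incfac d k x : A :=
  if d is d'.+1 then h k x * incfac d' k.+1 x else 1.

Fixpoint incprod d m z : A :=
  if d is d'.+1 then incprod d' m.+1 z * incfac d m (z m) else 1.

Fixpoint decprod d m z : A :=
  if d is d'.+1 then decfac d m (z m) * decprod d' m.+1 z else 1.

Fixpoint mixfac d m x z : A :=
  if d is d'.+1 then mixfac d' m.+1 x z * h m (oplus x (z m)) else 1.

Fixpoint mixprod d m (t z : nat -> P) : A :=
  if d is d'.+1
  then mixfac d m (t m) (fun j => z (j - m)%N) * mixprod d' m.+1 t z else 1.

Lemma decfacS d k x : decfac d.+1 k x = decfac d k.+1 x * h k x.
Proof. by []. Qed.

Lemma incfacS d k x : incfac d.+1 k x = h k x * incfac d k.+1 x.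
Proof. by []. Qed.

Lemma mixfacS d k x z :
  mixfac d.+1 k x z = mixfac d k.+1 x z * h k (oplus x (z k)).
Proof. by []. Qed.

Lemma incprodS d m z :
  incprod d.+1 m z = incprod d m.+1 z * incfac d.+1 m (z m).
Proof. by []. Qed.

Lemma decprodS d m z :
  decprod d.+1 m z = decfac d.+1 m (z m) * decprod d m.+1 z.
Proof. by []. Qed.

Lemma fac0E : (forall k x, decfac 0 k x = 1) * (forall k x, incfac 0 k x = 1)
  * (forall k x z, mixfac 0 k x z = 1) * (forall k z, incprod 0 k z = 1)
  * (forall k z, decprod 0 k z = 1).
Proof. by []. Qed.

Lemma mixprodS d m t z : mixprod d.+1 m t z
  = mixfac d.+1 m (t m) (fun j => z (j - m)%N) * mixprod d m.+1 t z.
Proof. by []. Qed.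

Lemma mixprod0 m t z : mixprod 0 m t z = 1.
Proof. by []. Qed.

Lemma h_comm i j x y : (i.+1 < j)%N -> h i x * h j y = h j y * h i x.
Proof.
by move=> ij; rewrite hfac_comm //; apply/esym/hfac_comm/esym/u_comm.
Qed.

Lemma decfac_comm i d k x y : (i.+1 < k)%N ->
  h i y * decfac d k x = decfac d k x * h i y.
Proof.
elim: d k => [|d IHd] k ik; first by rewrite !fac0E mul1r mulr1.
by rewrite decfacS mulrA (IHd _ (leqW ik)) -2!(mulrA (decfac _ _ _)) h_comm.
Qed.

Lemma incfac_comm i d k x y : (i.+1 < k)%N ->
  h i y * incfac d k x = incfac d k x * h i y.
Proof.
elim: d k => [|d IHd] k ik; first by rewrite !fac0E mul1r mulr1.
by rewrite incfacS mulrA h_comm // -2!(mulrA (h k x)) (IHd _ (leqW ik)).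
Qed.

Lemma incprod_comm i d k z y : (i.+1 < k)%N ->
  h i y * incprod d k z = incprod d k z * h i y.
Proof.
elim: d k => [|d IHd] k ik; first by rewrite !fac0E mul1r mulr1.
by rewrite incprodS mulrA (IHd _ (leqW ik)) -2!(mulrA (incprod _ _ _)) incfac_comm.
Qed.

Lemma decprod_comm i d k z y : (i.+1 < k)%N ->
  h i y * decprod d k z = decprod d k z * h i y.
Proof.
elim: d k => [|d IHd] k ik; first by rewrite !fac0E mul1r mulr1.
by rewrite decprodS mulrA decfac_comm // -2!(mulrA (decfac _ _ _)) (IHd _ (leqW ik)).
Qed.

(** B_k(y) A_k(x) = A_(k+1)(x) h_k(x (+) y) B_(k+1)(y). By induction the inner product is already
    exchanged; its outer parts commute with [h k], and the three factors that meet are those of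
    [yang_baxter]. *)
Lemma incfac_decfac d k x y :
  incfac d.+1 k y * decfac d.+1 k x =
    decfac d k.+1 x * h k (oplus x y) * incfac d k.+1 y.
Proof.
elim: d k => [|d IHd] k.
  rewrite !(decfacS, incfacS, fac0E) mulr1 !mul1r mulr1 hfacM //.
  by rewrite /oplus (addrC y) mulrC.
rewrite incfacS (decfacS d.+1) mulrA -(mulrA (h k y)) IHd decfacS incfacS !mulrA.
rewrite decfac_comm // -(mulrA _ _ (h k x)) -incfac_comm //.
rewrite !mulrA -!(mulrA (decfac d _ _)); congr (_ * _).
by rewrite yang_baxter.
Qed.

(** While [decfac] passes to the left, each increasing factor loses its first letter but keeps its
    parameter, whence [z j.-1]; the shortest factor becomes empty, whence [d.-1]. *)
Lemma incprod_decfac d m x z :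
  incprod d m z * decfac d m x
    = mixfac d m x z * incprod d.-1 m.+1 (fun j => z j.-1).
Proof.
elim: d m => [|d IHd] m; first by rewrite !fac0E !mulr1.
rewrite incprodS -mulrA incfac_decfac !mulrA IHd mixfacS.
case: d {IHd} => [|d]; first by rewrite /= !mulr1.
by rewrite -(mulrA (mixfac _ _ _ _)) -incprod_comm // incprodS !mulrA.
Qed.

Lemma eq_incprod d m z z' : z =1 z' -> incprod d m z = incprod d m z'.
Proof. by move=> eqz; elim: d m => [|d IHd] m; rewrite ?fac0E // !incprodS IHd eqz. Qed.

Lemma eq_decprod d m z z' : z =1 z' -> decprod d m z = decprod d m z'.
Proof. by move=> eqz; elim: d m => [|d IHd] m; rewrite ?fac0E // !decprodS IHd eqz. Qed.

Lemma incprod_decprod_shift d m t z :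
  incprod d m (fun j => z (j - m)%N) * decprod d m t = mixprod d m t z.
Proof.
elim: d m => [|d IHd] m; first by rewrite mixprod0 !fac0E mulr1.
rewrite decprodS mixprodS mulrA incprod_decfac -mulrA; congr (_ * _).
rewrite -IHd; congr (_ * _); apply: eq_incprod => j.
by rewrite subnS -!subn1 subnAC.
Qed.

Lemma incprod_decprod d t z : incprod d 0 z * decprod d 0 t = mixprod d 0 t z.
Proof.
rewrite -incprod_decprod_shift; congr (_ * _).
by apply: eq_incprod => j; rewrite subn0.
Qed.

(** The trailing factor [h k] makes the induction close: the statement at [k + 1] is exactly the
    hypothesis of [hfac_exchange], with [p] and [q] the products of the two blocks without the
    letter [k]. *)
Lemma decfac_exchange d k x y :
  decfac d.+1 k x * decfac d k.+1 y * h k y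
    = decfac d.+1 k y * decfac d k.+1 x * h k x.
Proof.
elim: d k => [|d IHd] k.
  by rewrite !(decfacS, fac0E) !mul1r !mulr1 !hfacM // /oplus (addrC x) mulrC.
have E a b : decfac d.+2 k a * decfac d.+1 k.+1 b * h k b
    = decfac d.+1 k.+1 a * decfac d k.+2 b * (h k a * h k.+1 b * h k b).
  rewrite decfacS (decfacS d k.+1 b) !mulrA -(mulrA (decfac d.+1 _ _) (h k a)).
  by rewrite decfac_comm // !mulrA.
by rewrite !E; apply: hfac_exchange.
Qed.

(** Only the blocks [i] and [i + 1] see the swap of parameters. The extra factor [h i] commutes with
    all later blocks, so it can be brought next to these two for [decfac_exchange]. *)
Lemma decprod_exchange d m i z z' : (m <= i)%N -> (i < m + d)%N ->
    z' i = z i.+1 -> z' i.+1 = z i ->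
    (forall j : nat, j != i -> j != i.+1 -> z' j = z j) ->
  decprod d m z * h i (z i.+1) = decprod d m z' * h i (z i).
Proof.
move=> le_mi lt_i z'i z'i1 z'E.
have eq_dec d1 k : (i.+1 < k)%N -> decprod d1 k z' = decprod d1 k z.
  elim: d1 k => // d1 IHd k ik; rewrite !decprodS (IHd _ (leqW ik)) z'E //.
    by rewrite gtn_eqF ?(ltn_trans _ ik).
  by rewrite gtn_eqF.
elim: d m le_mi lt_i => [|d IHd] m; first by rewrite addn0; case: leqP.
rewrite leq_eqVlt => /predU1P[-> _ | lt_mi lt_i]; last first.
  rewrite !decprodS -!(mulrA (decfac _ _ _)) IHd ?addSnnS // z'E //.
    by rewrite ltn_eqF.
  by rewrite ltn_eqF // ltnW.
(* If [i] is the last letter, block [i + 1] is empty and the two factors [h i] merge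
   symmetrically. *)
rewrite !decprodS; case: d {IHd} => [|d].
  rewrite z'i !(decfacS, fac0E) !mul1r !mulr1 !hfacM //.
  by rewrite /oplus (addrC (z i)) mulrC.
have tail (a b a' b' r g g' : A) : g * r = r * g -> g' * r = r * g' ->
    a * b * g = a' * b' * g' -> a * (b * r) * g = a' * (b' * r) * g'.
  by move=> gr g'r ab; rewrite !mulrA -2!(mulrA _ r) -gr -g'r !mulrA ab.
rewrite !decprodS z'i z'i1 eq_dec //.
by apply: tail; [exact: decprod_comm | exact: decprod_comm |
  exact: decfac_exchange].
Qed.

(** * The staircase word, which will represent the longest element *)

Fixpoint decword d k : seq nat :=
  if d is d'.+1 then rcons (decword d' k.+1) k else [::].

Fixpoint stairword d m : seq nat :=
  if d is d'.+1 then decword d m ++ stairword d' m.+1 else [::].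

Local Notation uw s := (\prod_(i <- s) u i).

Lemma decwordS d k : uw (decword d.+1 k) = uw (decword d k.+1) * u k.
Proof. by rewrite /= -cats1 big_cat big_seq1. Qed.

Lemma decword_comm i d k : (i.+1 < k)%N ->
  u i * uw (decword d k) = uw (decword d k) * u i.
Proof.
elim: d k => [|d IHd] k ik; first by rewrite !big_nil mul1r mulr1.
by rewrite decwordS mulrA (IHd _ (leqW ik)) -2!(mulrA (uw _)) u_comm.
Qed.

(** The braid relation turns a letter crossing the decreasing word into the next letter; the largest
    letter equals the first one of the word and is absorbed by idempotence. *)
Lemma decword_push i d k : (i < d)%N ->
  u (k + i)%N * uw (decword d k) =
    if (i.+1 == d)%N then uw (decword d k) else uw (decword d k) * u (k + i.+1)%N.
Proof.
elim: d i k => // d IHd [|i] k lt_id.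
  rewrite addn0 eqSS addn1; case: d {IHd lt_id} => [|d].
    by rewrite decwordS big_nil mul1r.
  rewrite !decwordS 2!mulrA decword_comm // -!(mulrA (uw _)).
  by rewrite u_braid.
rewrite decwordS mulrA addnS -addSn IHd // eqSS; case: eqP => // _.
by rewrite -!(mulrA (uw _)) addSnnS [u k * _]u_comm //; lia.
Qed.

(* The letter crosses each block as the next letter, until it reaches the     *)
(* first letter of a block and is absorbed there.                             *)
Lemma stairword_absorb i d m : (i < d)%N ->
  u (m + i)%N * uw (stairword d m) = uw (stairword d m).
Proof.
elim: d i m => // d IHd i m lt_id; rewrite big_cat mulrA decword_push //.
case: eqP => // neq_id; rewrite -mulrA -addSnnS IHd //.
by move: lt_id neq_id; rewrite ltnS leq_eqVlt => /predU1P[->|].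
Qed.
End HeckeGenerators.

(** * The 0-Hecke monoid *)

Section HeckeMonoid.
Variable n : nat.
Implicit Types (i j : 'I_n) (w a b c : seq 'I_n) (s t r : 'S_n.+1).
Local Open Scope group_scope.

Local Notation tp i := (tperm (lo i) (hi i)).
Local Notation hecke w := (foldr (@hecke_op n) 1 w).

(** The mirror image of [hecke_op], acting on positions instead of values. *)
Definition hecke_opr i s : 'S_n.+1 := (hecke_op i s^-1)^-1.

Lemma lo_val i : lo i = i :> nat. Proof. by []. Qed.
Lemma hi_val i : hi i = i.+1 :> nat. Proof. by []. Qed.

Lemma ord_neq (x y : 'I_n.+1) : x <> y :> nat -> x != y.
Proof. by move=> neq_xy; apply/eqP => eq_xy; case: neq_xy; rewrite eq_xy. Qed.

Lemma lo_neq_hi i : lo i != hi i.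
Proof. by rewrite -val_eqE /= neq_ltn ltnSn. Qed.

Lemma ltn_lo_hi i : (lo i < hi i)%N.
Proof. exact: ltnSn. Qed.

Lemma ltn_hi_lo i : (hi i < lo i)%N = false.
Proof. by apply: negbTE; rewrite -leqNgt ltnW ?ltn_lo_hi. Qed.

Lemma hecke_oprE i s :
  hecke_opr i s = if (s (lo i) < s (hi i))%N then tp i * s else s.
Proof.
by rewrite /hecke_opr /hecke_op invgK; case: ifP => _; rewrite ?invMg ?tpermV ?invgK.
Qed.

Lemma tperm_mono i (x y : 'I_n.+1) :
  (x < y)%N -> ~~ ((x == lo i) && (y == hi i)) -> (tp i x < tp i y)%N.
Proof.
have neq_val (a b : 'I_n.+1) : a <> b -> a <> b :> nat by move=> ab /val_inj.
rewrite -!val_eqE; case: tpermP => [->|->|/neq_val xl /neq_val xh];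
  case: tpermP => [->|->|/neq_val yl /neq_val yh]; rewrite ?hi_val ?lo_val /=.
all: try rewrite hi_val in xh; try rewrite lo_val in xl.
all: try rewrite hi_val in yh; try rewrite lo_val in yl; lia.
Qed.

Lemma tperm_ltE i (x y : 'I_n.+1) :
    (x, y) != (lo i, hi i) -> (x, y) != (hi i, lo i) ->
  (tp i x < tp i y)%N = (x < y)%N.
Proof.
rewrite !xpair_eqE => Nxy Nyx; apply/idP/idP => [|lt_xy]; last exact: tperm_mono.
case: (ltngtP x y) => // [lt_yx | /val_inj->]; last by rewrite ltnn.
by rewrite ltnNge ltnW // tperm_mono // andbC.
Qed.

Lemma mul_tperm (p q : 'I_n.+1) s : tperm p q * s = s * tperm (s p) (s q).
Proof. by rewrite -tpermJ /conjg !mulgA mulgV mul1g. Qed.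

(** If the positions [j], [j + 1] hold the values [i], [i + 1], both operators perform the same
    sorting step. Otherwise neither changes the comparison made by the other. Associativity of the
    0-Hecke product comes from this commutation. *)
Lemma hecke_op_opr i j s :
  hecke_op i (hecke_opr j s) = hecke_opr j (hecke_op i s).
Proof.
have [/eqP[slo shi] | Nup] := boolP ((s (lo j), s (hi j)) == (lo i, hi i)).
  have Vlo : s^-1 (lo i) = lo j by rewrite -slo permK.
  have Vhi : s^-1 (hi i) = hi j by rewrite -shi permK.
  rewrite !hecke_oprE slo shi ltn_lo_hi /hecke_op Vlo Vhi ltn_lo_hi.
  rewrite mul_tperm slo shi !permM invMg !permM slo shi tpermV tpermL tpermR.
  by rewrite Vlo Vhi !ltn_hi_lo.
have [/eqP[slo shi] | Ndn] := boolP ((s (lo j), s (hi j)) == (hi i, lo i)).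
  have Vhi : s^-1 (hi i) = lo j by rewrite -slo permK.
  have Vlo : s^-1 (lo i) = hi j by rewrite -shi permK.
  rewrite !hecke_oprE slo shi ltn_hi_lo /hecke_op Vlo Vhi ltn_hi_lo.
  by rewrite slo shi ltn_hi_lo.
have ltE : ((s * tp i)%g (lo j) < (s * tp i)%g (hi j))%N = (s (lo j) < s (hi j))%N.
  by rewrite !permM tperm_ltE.
have ltVE : ((tp j * s)^-1%g (lo i) < (tp j * s)^-1%g (hi i))%N
    = (s^-1%g (lo i) < s^-1%g (hi i))%N.
  rewrite invMg tpermV !permM tperm_ltE //.
    by apply: contraNneq Nup => -[<- <-]; rewrite !permKV.
  by apply: contraNneq Ndn => -[<- <-]; rewrite !permKV.
rewrite !hecke_oprE /hecke_op.
have [lt1|ge1] := boolP (s (lo j) < s (hi j))%N;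
  have [lt2|ge2] := boolP (s^-1%g (lo i) < s^-1%g (hi i))%N;
  by rewrite ?ltE ?ltVE ?lt1 ?lt2 ?(negPf ge1) ?(negPf ge2) ?mulgA.
Qed.

Lemma hecke_op1 i : hecke_op i 1 = tp i.
Proof. by rewrite /hecke_op invg1 !perm1 ltn_lo_hi mul1g. Qed.

Lemma hecke_opr1 i : hecke_opr i 1 = tp i.
Proof. by rewrite /hecke_opr invg1 hecke_op1 tpermV. Qed.

Lemma foldr_hecke_opr w j s :
  foldr (@hecke_op n) (hecke_opr j s) w = hecke_opr j (foldr (@hecke_op n) s w).
Proof. by elim: w => //= i w ->; rewrite hecke_op_opr. Qed.

Lemma foldr_hecke_oprs w a s :
  foldr (@hecke_op n) (foldr hecke_opr s a) w
    = foldr hecke_opr (foldr (@hecke_op n) s w) a.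
Proof. by elim: a => //= j a <-; rewrite foldr_hecke_opr. Qed.

Lemma foldr_hecke_oprV w s :
  (foldr (@hecke_op n) s w)^-1 = foldr hecke_opr s^-1 w.
Proof. by elim: w => //= i w IHw; rewrite -IHw /hecke_opr invgK. Qed.

(* The exchange property: the letter deleted from [w] is the one at which the *)
(* values at positions [p] and [q] get out of order.                          *)
Lemma word_perm_exchange w (p q : 'I_n.+1) : (p < q)%N ->
    (word_perm w q < word_perm w p)%N ->
  exists2 w', (size w' < size w)%N & word_perm w' = tperm p q * word_perm w.
Proof.
move=> lt_pq; elim: w => [|i w IHw] /=; first by rewrite !perm1 ltnNge ltnW.
rewrite !permM.
have [/IHw[w' lt_w' Dw'] _ | ge_pq] := boolP (word_perm w q < word_perm w p)%N.
  exists (i :: w'); first by rewrite /= ltnS.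
  by rewrite /= Dw' mulgA.
have lt_w : (word_perm w p < word_perm w q)%N.
  rewrite ltn_neqAle leqNgt ge_pq andbT (inj_eq val_inj) (inj_eq perm_inj).
  by rewrite -val_eqE ltn_eqF.
have [/andP[/eqP wp /eqP wq] _ | Nlohi] :=
    boolP ((word_perm w p == lo i) && (word_perm w q == hi i)).
  by exists w => //=; rewrite -wp -wq -mul_tperm mulgA tperm2 mul1g.
by rewrite ltnNge ltnW // tperm_mono.
Qed.

Lemma reducedP w :
  reflect (forall w', word_perm w' = word_perm w -> (size w <= size w')%N)
          (reduced w).
Proof.
apply: (iffP forallP) => [redw w' Dw' | min_w k].
  rewrite leqNgt; apply/negP => lt_w'; have /forallP := redw (Ordinal lt_w').
  by move/(_ (in_tuple w')); rewrite Dw' eqxx.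
apply/forallP => w'; apply: contraTneq (ltn_ord k) => /min_w.
by rewrite size_tuple -leqNgt.
Qed.

Lemma reduced_behead i w : reduced (i :: w) -> reduced w.
Proof.
move=> /reducedP redw; apply/reducedP => w' Dw'.
by rewrite -ltnS (redw (i :: w')) //= Dw'.
Qed.

(** Otherwise the exchange property would produce a word for [word_perm (i :: w)] shorter than
    [w]. *)
Lemma reduced_ascent i w : reduced (i :: w) ->
  ((word_perm w)^-1%g (lo i) < (word_perm w)^-1%g (hi i))%N.
Proof.
move=> /reducedP redw; rewrite ltnNge leq_eqVlt; apply/negP => /predU1P[|lt_hi].
  by move=> /val_inj/perm_inj/eqP; rewrite eq_sym (negPf (lo_neq_hi i)).
have [|w' lt_w' Dw'] := word_perm_exchange lt_hi (w := w).
  by rewrite !permKV ltn_lo_hi.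
suff /redw : word_perm w' = word_perm (i :: w) by rewrite /= ltnNge ltnW.
by rewrite Dw' mul_tperm !permKV tpermC.
Qed.

Lemma hecke_reduced w : reduced w -> hecke w = word_perm w.
Proof.
elim: w => //= i w IHw red_iw; rewrite (IHw (reduced_behead red_iw)).
by rewrite /hecke_op (reduced_ascent red_iw).
Qed.

Lemma reduced_wordE s : word_perm (reduced_word s) = s.
Proof. by have /andP[/eqP] := xchooseP (reduced_wordP s). Qed.

Lemma reduced_reduced_word s : reduced (reduced_word s).
Proof. by have /andP[] := xchooseP (reduced_wordP s). Qed.

Lemma hecke_reduced_word s : hecke (reduced_word s) = s.
Proof. by rewrite hecke_reduced ?reduced_reduced_word // reduced_wordE. Qed.

(** The Demazure product. By [hecke_mulE] any Hecke word of [s] may replace the chosen reduced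
    word. *)
Definition hecke_mul s t : 'S_n.+1 := foldr (@hecke_op n) t (reduced_word s).

Lemma opr_reduced_word s : foldr hecke_opr 1 (reduced_word s^-1) = s.
Proof.
by rewrite -{1}invg1 -foldr_hecke_oprV hecke_reduced_word invgK.
Qed.

(** Write [t] as a right word acting on 1. Since left and right actions commute, the result is that
    right word acting on [hecke w], so it depends on [w] only through [hecke w]. *)
Lemma hecke_mulE w t : hecke_mul (hecke w) t = foldr (@hecke_op n) t w.
Proof.
rewrite /hecke_mul -(opr_reduced_word t) !foldr_hecke_oprs.
by rewrite hecke_reduced_word.
Qed.

Lemma hecke_mulrE s w : hecke_mul s (foldr hecke_opr 1 w) = foldr hecke_opr s w.
Proof. by rewrite /hecke_mul foldr_hecke_oprs hecke_reduced_word. Qed.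

Lemma hecke_cat a b : hecke (a ++ b) = hecke_mul (hecke a) (hecke b).
Proof. by rewrite hecke_mulE foldr_cat. Qed.

Lemma hecke_mulA : associative hecke_mul.
Proof.
move=> s t r; rewrite -(hecke_reduced_word s) -(hecke_reduced_word t).
by rewrite -hecke_cat !hecke_mulE foldr_cat.
Qed.

Lemma hecke_mul1 : left_id 1 hecke_mul.
Proof. by move=> t; rewrite (hecke_mulE [::]). Qed.

Lemma hecke_mulr1 : right_id 1 hecke_mul.
Proof. exact: hecke_reduced_word. Qed.

Lemma hecke_mulV s t : (hecke_mul s t)^-1 = hecke_mul t^-1 s^-1.
Proof.
rewrite -{1}(hecke_reduced_word s) -{1}(opr_reduced_word t) hecke_mulrE.
rewrite /hecke_mul hecke_reduced_word -{1}(invgK s).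
by rewrite -foldr_hecke_oprV invgK.
Qed.

Lemma hecke_mul_tp i s : hecke_mul (tp i) s = hecke_op i s.
Proof. by rewrite -hecke_op1 (hecke_mulE [:: i]). Qed.

Lemma hecke_mul_tpr i s : hecke_mul s (tp i) = hecke_opr i s.
Proof. by rewrite -hecke_opr1 (hecke_mulrE s [:: i]). Qed.

Lemma hecke_pairsE s (p : 'S_n.+1 * 'S_n.+1) :
  (p \in hecke_pairs s) = (hecke_mul p.1 p.2 == s).
Proof.
rewrite inE; apply/boolp.asboolP/eqP => [[a [b []]] | <-].
  by rewrite /represents => /eqP<- /eqP<- /eqP<-; rewrite hecke_cat.
exists (reduced_word p.1), (reduced_word p.2).
by rewrite /represents hecke_cat !hecke_reduced_word !eqxx.
Qed.

Lemma hecke_mul_idem i : hecke_mul (tp i) (tp i) = tp i.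
Proof.
by rewrite hecke_mul_tp /hecke_op tpermV tpermL tpermR ltn_hi_lo.
Qed.

Lemma hecke_mul_comm i j : (i.+1 < j)%N ->
  hecke_mul (tp i) (tp j) = hecke_mul (tp j) (tp i).
Proof.
move=> lt_ij.
have [tlo thi] : tp j (lo i) = lo i /\ tp j (hi i) = hi i.
  by split; rewrite tpermD //; apply: ord_neq; rewrite ?hi_val ?lo_val; lia.
have [tlo' thi'] : tp i (lo j) = lo j /\ tp i (hi j) = hi j.
  by split; rewrite tpermD //; apply: ord_neq; rewrite ?hi_val ?lo_val; lia.
rewrite !hecke_mul_tp /hecke_op !tpermV tlo thi tlo' thi' !ltn_lo_hi.
by rewrite mul_tperm tlo' thi'.
Qed.

Lemma hecke_mul_braid i j : j = i.+1 :> nat ->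
  hecke_mul (hecke_mul (tp i) (tp j)) (tp i)
    = hecke_mul (hecke_mul (tp j) (tp i)) (tp j).
Proof.
move=> Dj; have Dlo : lo j = hi i by apply: ord_inj; rewrite hi_val.
have [lt_ab lt_bc] : (lo i < hi i)%N /\ (hi i < hi j)%N.
  by rewrite !hi_val lo_val Dj.
have tiE : tp i (hi j) = hi j.
  by rewrite tpermD //; apply: ord_neq; rewrite ?hi_val ?lo_val; lia.
have tjE : tp j (lo i) = lo i.
  by rewrite tpermD //; apply: ord_neq; rewrite ?hi_val ?lo_val; lia.
have tiR : tp i (lo j) = lo i by rewrite Dlo tpermR.
have tjL : tp j (hi i) = hi j by rewrite -Dlo tpermL.
rewrite -!hecke_mulA !hecke_mul_tp.
have -> : hecke_op j (tp i) = tp i * tp j.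
  by rewrite /hecke_op tpermV tiR tiE (ltn_trans lt_ab).
have -> : hecke_op i (tp j) = tp j * tp i.
  by rewrite /hecke_op tpermV tjL tjE (ltn_trans lt_ab).
have -> : hecke_op i (tp i * tp j) = tp i * tp j * tp i.
  by rewrite /hecke_op invMg !tpermV !permM tjE tpermL tjL tiE lt_bc.
have -> : hecke_op j (tp j * tp i) = tp j * tp i * tp j.
  by rewrite /hecke_op invMg !tpermV !permM tiE tiR tjE tpermR Dlo lt_ab.
rewrite [tp i * tp j]mul_tperm tjE tjL -!mulgA; congr (_ * _).
by rewrite mul_tperm tpermL tiE -Dlo.
Qed.

(** * Inversions and the longest element *)

Definition inv_set s : {set 'I_n.+1 * 'I_n.+1} :=
  [set p : 'I_n.+1 * 'I_n.+1 | (p.1 < p.2)%N && (s p.2 < s p.1)%N].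

Definition inversions s := #|inv_set s|.

Lemma inversions1 : inversions 1 = 0.
Proof.
apply/eqP; rewrite cards_eq0; apply/eqP/setP => p; rewrite !inE !perm1.
by case: ltngtP.
Qed.

(** The only pair of positions that can become inverted is that of the values [i] and [i + 1]. Hence
    no Hecke word is shorter than the number of inversions. *)
Lemma inversions_op i s : (inversions (hecke_op i s) <= (inversions s).+1)%N.
Proof.
rewrite /hecke_op; case: ifP => // _.
rewrite -[(inversions s).+1]addn1 -(cards1 (s^-1%g (lo i), s^-1%g (hi i))).
apply: leq_trans (leq_card_setU _ _); apply: subset_leq_card.
apply/subsetP => -[p q]; rewrite !inE /= !permM => /andP[-> lt_st] /=.
have [//|] := boolP (s q < s p)%N; rewrite -leqNgt leq_eqVlt => /predU1P[|lt_s].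
  by move=> /ord_inj/perm_inj pq; move: lt_st; rewrite pq ltnn.
suff /andP[/eqP<- /eqP<-] : (s p == lo i) && (s q == hi i).
  by rewrite !permK eqxx.
by apply: contraTT lt_st => Nlohi; rewrite -leqNgt ltnW // tperm_mono.
Qed.

Lemma inversions_w0 : inversions (w0 n) = (\sum_(k < n.+1) (n - k))%N.
Proof.
rewrite /inversions -sum1_card.
transitivity (\sum_(k < n.+1) \sum_(l < n.+1 | (k < l)%N) 1)%N.
  rewrite pair_big_dep; apply: eq_bigl => -[k l]; rewrite inE !permE /=.
  by have := ltn_ord l; have := ltn_ord k; lia.
apply: eq_bigr => k _.
transitivity (\sum_(k.+1 <= l < n.+1) 1)%N; first by rewrite big_geq_mkord.
by rewrite sum_nat_const_nat muln1 subSS.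
Qed.

(** No operator acts, so the positions [f k] of the values 0, ..., n strictly decrease; n + 1
    strictly decreasing numbers between 0 and n must be n, ..., 0. *)
Lemma w0_eq s : (forall i, hecke_op i s = s) -> s = w0 n.
Proof.
move=> fix_s; pose f k : nat := s^-1%g (inord k).
have f_desc k : (k < n)%N -> (f k.+1 < f k)%N.
  move=> lt_kn; pose i := Ordinal lt_kn.
  have Dlo : inord k = lo i by apply: ord_inj; rewrite inordK // ltnW.
  have Dhi : inord k.+1 = hi i by apply: ord_inj; rewrite inordK.
  rewrite /f Dlo Dhi.
  rewrite ltnNge leq_eqVlt; apply/negP => /predU1P[/ord_inj/perm_inj/eqP|lt_lohi].
    by rewrite (negPf (lo_neq_hi i)).
  have := fix_s i; rewrite /hecke_op lt_lohi => /(canRL (mulKg s)).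
  rewrite mulVg => /permP/(_ (lo i)); rewrite tpermL perm1 => /eqP.
  by rewrite eq_sym (negPf (lo_neq_hi i)).
have f_le k : (k <= n)%N -> (f k + k <= n)%N.
  elim: k => [_|k IHk lt_kn]; first by rewrite addn0 -ltnS ltn_ord.
  by have := f_desc k lt_kn; have := IHk (ltnW lt_kn); lia.
have f_ge d k : (k + d = n)%N -> (d <= f k)%N.
  elim: d k => // d IHd k Dn; have := f_desc k; have := IHd k.+1; lia.
have Vw0 : (w0 n)^-1 = w0 n.
  apply/eqP; rewrite eq_invg_mul; apply/eqP/permP => j.
  by rewrite permM !permE rev_ordK.
suff Vs : s^-1 = w0 n by rewrite -[s]invgK Vs Vw0.
apply/permP => k; apply: ord_inj; rewrite -[in LHS](inord_val k) [in RHS]permE /=.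
have le_kn : (k <= n)%N by rewrite -ltnS.
have := f_le k le_kn; have := f_ge (n - k)%N k (subnKC le_kn); rewrite /f; lia.
Qed.

End HeckeMonoid.

(** * Algebras of finite monoids *)

(** A named copy of [{ffun T -> P}] indexed by [op], so that convolution can be declared as its ring
    product. *)
Definition monoid_alg (T : finType) (e : T) (op : Monoid.law e)
  (P : comNzRingType) := {ffun T -> P}.

Section MonoidAlgebra.
Variables (T : finType) (e : T) (op : Monoid.law e) (P : comNzRingType).
Local Notation A := (monoid_alg op P).
Implicit Types (f g h : A) (s t : T) (x y : P).

HB.instance Definition _ := GRing.Zmodule.copy A {ffun T -> P}.

Definition ma_delta s : A := [ffun t => (t == s)%:R].
Definition ma_scale x f : A := [ffun t => x * f t].
Definition ma_mul f g : A :=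
  [ffun s => \sum_t \sum_r f t * g r * (op t r == s)%:R].

Lemma sum_ma_mul f g (phi : T -> P) :
  \sum_s phi s * ma_mul f g s = \sum_t \sum_r f t * g r * phi (op t r).
Proof.
under eq_bigr do rewrite ffunE mulr_sumr.
rewrite exchange_big; apply: eq_bigr => t _.
under eq_bigr do rewrite mulr_sumr.
rewrite exchange_big; apply: eq_bigr => r _.
rewrite (bigD1 (op t r)) //= eqxx mulr1 big1 ?addr0 1?mulrC // => s.
by rewrite eq_sym => /negPf->; rewrite !mulr0.
Qed.

Lemma sum_delta (phi : T -> P) s : \sum_t (t == s)%:R * phi t = phi s.
Proof.
rewrite (bigD1 s) //= eqxx mul1r big1 ?addr0 // => t /negPf->.
by rewrite mul0r.
Qed.

Lemma ma_mulA : associative ma_mul.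
Proof.
move=> f g h; apply/ffunP => s; rewrite !ffunE.
transitivity (\sum_t \sum_r \sum_q f t * g r * h q * (op t (op r q) == s)%:R).
  apply: eq_bigr => t _; under eq_bigr do rewrite mulrAC.
  rewrite (sum_ma_mul g h (fun b => f t * (op t b == s)%:R)).
  do 2!apply: eq_bigr => ? _; rewrite !mulrA; congr (_ * _).
  by rewrite mulrC mulrA.
under [RHS]eq_bigr => a _.
  under eq_bigr do rewrite -mulrA mulrC.
  rewrite -mulr_suml; over.
rewrite sum_ma_mul; do 2!apply: eq_bigr => ? _.
by rewrite mulr_sumr; apply: eq_bigr => q _; rewrite Monoid.mulmA mulrA.
Qed.

Lemma ma_mul1 : left_id (ma_delta e) ma_mul.
Proof.
move=> f; apply/ffunP => s; rewrite ffunE exchange_big /=.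
transitivity (\sum_r f r * (r == s)%:R).
  apply: eq_bigr => r _; under eq_bigr do rewrite ffunE -mulrA.
  by rewrite (sum_delta (fun t => f r * (op t r == s)%:R)) Monoid.mul1m.
by under eq_bigr do rewrite mulrC; rewrite sum_delta.
Qed.

Lemma ma_mulr1 : right_id (ma_delta e) ma_mul.
Proof.
move=> f; apply/ffunP => s; rewrite ffunE.
transitivity (\sum_r f r * (r == s)%:R).
  apply: eq_bigr => r _; under eq_bigr do rewrite ffunE (mulrC (f r)) -mulrA.
  by rewrite (sum_delta (fun t => f r * (op r t == s)%:R)) Monoid.mulm1.
by under eq_bigr do rewrite mulrC; rewrite sum_delta.
Qed.

Lemma ma_mulDl : left_distributive ma_mul +%R.
Proof.
move=> f g h; apply/ffunP => s; rewrite !ffunE -big_split; apply: eq_bigr => t _.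
by rewrite -big_split; apply: eq_bigr => r _; rewrite ffunE !mulrDl.
Qed.

Lemma ma_mulDr : right_distributive ma_mul +%R.
Proof.
move=> f g h; apply/ffunP => s; rewrite !ffunE -big_split; apply: eq_bigr => t _.
by rewrite -big_split; apply: eq_bigr => r _; rewrite ffunE mulrDr mulrDl.
Qed.

Lemma ma_1neq0 : ma_delta e != 0.
Proof.
by apply/eqP => /ffunP/(_ e); rewrite !ffunE eqxx; apply/eqP/oner_neq0.
Qed.

HB.instance Definition _ := GRing.Zmodule_isNzRing.Build A
  ma_mulA ma_mul1 ma_mulr1 ma_mulDl ma_mulDr ma_1neq0.

Lemma ma_scaleA x y f : ma_scale x (ma_scale y f) = ma_scale (x * y) f.
Proof. by apply/ffunP => s; rewrite !ffunE mulrA. Qed.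

Lemma ma_scale1 : left_id 1 ma_scale.
Proof. by move=> f; apply/ffunP => s; rewrite ffunE mul1r. Qed.

Lemma ma_scaleDr : right_distributive ma_scale +%R.
Proof. by move=> x f g; apply/ffunP => s; rewrite !ffunE mulrDr. Qed.

Lemma ma_scaleDl f : {morph ma_scale^~ f : x y / x + y}.
Proof. by move=> x y; apply/ffunP => s; rewrite !ffunE mulrDl. Qed.

HB.instance Definition _ := GRing.Zmodule_isLmodule.Build P A
  ma_scaleA ma_scale1 ma_scaleDr ma_scaleDl.

Lemma ma_scaleAl x f g : x *: (f * g) = (x *: f) * g.
Proof.
apply/ffunP => s; rewrite !ffunE mulr_sumr; apply: eq_bigr => t _.
by rewrite mulr_sumr; apply: eq_bigr => r _; rewrite ffunE !mulrA.
Qed.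

Lemma ma_scaleAr x f g : x *: (f * g) = f * (x *: g).
Proof.
apply/ffunP => s; rewrite !ffunE mulr_sumr; apply: eq_bigr => t _.
by rewrite mulr_sumr; apply: eq_bigr => r _; rewrite ffunE !mulrA (mulrC x).
Qed.

HB.instance Definition _ := GRing.Lmodule_isLalgebra.Build P A ma_scaleAl.
HB.instance Definition _ := GRing.Lalgebra_isAlgebra.Build P A ma_scaleAr.

Lemma ma_addE f g s : (f + g) s = f s + g s.
Proof. by rewrite ffunE. Qed.

Lemma ma_scaleE x f s : (x *: f) s = x * f s.
Proof. by rewrite ffunE. Qed.

Lemma ma_sumE I (r : seq I) (Q : pred I) (F : I -> A) s :
  (\sum_(i <- r | Q i) F i) s = \sum_(i <- r | Q i) F i s.
Proof.
by elim/big_rec2: _ => [|i y f _ <-]; rewrite ffunE.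
Qed.

Lemma ma_mulE f g s :
  (f * g) s = \sum_(p | op p.1 p.2 == s) f p.1 * g p.2.
Proof.
rewrite ffunE pair_big [RHS]big_mkcond; apply: eq_bigr => -[t r] _ /=.
by case: eqP; rewrite ?mulr1 ?mulr0.
Qed.

Lemma ma_1E s : (1 : A) s = (s == e)%:R.
Proof. by rewrite ffunE. Qed.

Lemma mul_deltaE s f t : (ma_delta s * f) t = \sum_(r | op s r == t) f r.
Proof.
rewrite ffunE exchange_big [RHS]big_mkcond; apply: eq_bigr => r _.
under eq_bigr do rewrite ffunE -mulrA.
rewrite (sum_delta (fun q => f r * (op q r == t)%:R)).
by case: eqP; rewrite ?mulr1 ?mulr0.
Qed.

Lemma mulr_deltaE s f t : (f * ma_delta s) t = \sum_(r | op r s == t) f r.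
Proof.
rewrite ffunE [RHS]big_mkcond; apply: eq_bigr => r _.
under eq_bigr do rewrite ffunE (mulrC (f r)) -mulrA.
rewrite (sum_delta (fun q => f r * (op r q == t)%:R)).
by case: eqP; rewrite ?mulr1 ?mulr0.
Qed.

Lemma ma_deltaM s t : ma_delta s * ma_delta t = ma_delta (op s t).
Proof.
apply/ffunP => r; rewrite mul_deltaE ffunE big_mkcond (bigD1 t) //= ffunE eqxx.
rewrite big1 => [|q /negPf Nqt]; last by rewrite ffunE Nqt if_same.
by rewrite addr0 eq_sym; case: eqP.
Qed.

End MonoidAlgebra.

Section MonoidAlgebraMap.
Variables (T : finType) (e : T) (op : Monoid.law e) (P Q : comNzRingType).
Variable phi : {rmorphism P -> Q}.

Definition ma_map (f : monoid_alg op P) : monoid_alg op Q := [ffun s => phi (f s)].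

Lemma ma_mapE f s : ma_map f s = phi (f s).
Proof. by rewrite ffunE. Qed.

Lemma ma_mapD : {morph ma_map : f g / f + g}.
Proof. by move=> f g; apply/ffunP => s; rewrite !ffunE rmorphD. Qed.

Lemma ma_mapM : {morph ma_map : f g / f * g}.
Proof.
move=> f g; apply/ffunP => s; rewrite ffunE !ma_mulE rmorph_sum.
by apply: eq_bigr => p _; rewrite !ffunE rmorphM.
Qed.

Lemma ma_map_delta s : ma_map (ma_delta op P s) = ma_delta op Q s.
Proof. by apply/ffunP => t; rewrite !ffunE rmorph_nat. Qed.

Lemma ma_map1 : ma_map 1 = 1.
Proof. exact: ma_map_delta. Qed.

Lemma ma_mapZ x f : ma_map (x *: f) = phi x *: ma_map f.
Proof. by apply/ffunP => s; rewrite !ffunE rmorphM. Qed.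

Lemma ma_map_hfac x s :
  ma_map (hfac x (ma_delta op P s)) = hfac (phi x) (ma_delta op Q s).
Proof. by rewrite ma_mapD ma_map1 ma_mapZ ma_map_delta. Qed.
End MonoidAlgebraMap.

(** * The generating series of Grothendieck polynomials *)

HB.instance Definition _ n := Monoid.isLaw.Build 'S_n.+1 1%g (@hecke_mul n)
  (@hecke_mulA n) (@hecke_mul1 n) (@hecke_mulr1 n).

Section HeckeAlgebra.
Variables (n : nat) (P : comNzRingType).
Implicit Types (i : 'I_n) (s t : 'S_n.+1).

Definition hecke_law : Monoid.law 1%g := @hecke_mul n.
Local Notation H := (monoid_alg hecke_law P).

Definition gen i : H := ma_delta hecke_law P (tperm (lo i) (hi i)).

(* Letters that do not exist are sent to 0, so that the braid relations hold *)
(* for all natural numbers.                                                  *)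
Definition ngen (j : nat) : H := if insub j is Some i then gen i else 0.

Definition ext (x : 'I_n.+1 -> P) (k : nat) : P :=
  if insub k is Some i then x i else 0.

Lemma ngenE i : ngen i = gen i.
Proof. by rewrite /ngen valK. Qed.

Variant ngen_spec (j : nat) : H -> Type :=
  | NgenIn i of j = i : ngen_spec j (gen i)
  | NgenOut of (n <= j)%N : ngen_spec j 0.

Lemma ngenP j : ngen_spec j (ngen j).
Proof.
rewrite /ngen; case: insubP => [i _ <-|]; first exact: NgenIn.
by rewrite -leqNgt; apply: NgenOut.
Qed.

Lemma extE x (k : 'I_n.+1) : ext x k = x k.
Proof. by rewrite /ext valK. Qed.

Lemma genM i s : gen i * ma_delta hecke_law P s = ma_delta hecke_law P (hecke_op i s).
Proof. by rewrite ma_deltaM -hecke_mul_tp. Qed.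

Lemma ngen_idem j : ngen j * ngen j = ngen j.
Proof.
case: ngenP => [i _|_]; last by rewrite mul0r.
by rewrite /gen ma_deltaM /= hecke_mul_idem.
Qed.

Lemma ngen_comm j k : (j.+1 < k)%N -> ngen j * ngen k = ngen k * ngen j.
Proof.
case: ngenP => [i ->|_]; last by rewrite mul0r mulr0.
case: ngenP => [i' -> lt_ii'|_]; last by rewrite mul0r mulr0.
by rewrite /gen !ma_deltaM /= hecke_mul_comm.
Qed.

Lemma ngen_braid j :
  ngen j * ngen j.+1 * ngen j = ngen j.+1 * ngen j * ngen j.+1.
Proof.
case: (ngenP j) => [i Dj|_]; last by rewrite !(mul0r, mulr0).
case: (ngenP j.+1) => [i' Di'|_]; last by rewrite !(mul0r, mulr0).
by rewrite /gen !ma_deltaM /= hecke_mul_braid // -Di' Dj.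
Qed.

Lemma gen_mulE i (f : H) s : (gen i * f) s = \sum_(t | hecke_op i t == s) f t.
Proof.
by rewrite mul_deltaE; apply: eq_bigl => t; rewrite -hecke_mul_tp.
Qed.

Lemma gen_mulrE i (f : H) s : (f * gen i) s = \sum_(t | hecke_opr i t == s) f t.
Proof.
by rewrite mulr_deltaE; apply: eq_bigl => t; rewrite -hecke_mul_tpr.
Qed.

(** Every value of [hecke_opr i] has a descent at [i]. *)
Lemma gen_mulrE_asc i (f : H) s : (s (lo i) < s (hi i))%N -> (f * gen i) s = 0.
Proof.
move=> asc_s; rewrite gen_mulrE big_pred0 // => t.
apply/eqP => Dt; move: asc_s; rewrite -Dt hecke_oprE; case: ifP; last by move->.
by rewrite !permM tpermL tpermR => lt_t; rewrite ltnNge ltnW.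
Qed.

(** The preimages of [s] under [hecke_opr i] are [s] itself and [s] with the descent at [i]
    undone. *)
Lemma gen_mulrE_desc i (f : H) s : (s (hi i) < s (lo i))%N ->
  (f * gen i) s = f s + f (tperm (lo i) (hi i) * s)%g.
Proof.
move=> desc_s; rewrite gen_mulrE; set s' := (_ * s)%g.
have asc_s' : (s' (lo i) < s' (hi i))%N by rewrite !permM tpermL tpermR.
have neq_s : s' != s.
  by apply: contraTneq desc_s => <-; rewrite -leqNgt ltnW.
rewrite (bigD1 s) /=; last by rewrite hecke_oprE ltnNge ltnW.
rewrite (bigD1 s') /=; last first.
  by rewrite neq_s hecke_oprE asc_s' /s' mulgA tperm2 mul1g eqxx.
rewrite big1 ?addr0 // => t /andP[/andP[/eqP Dt Nts] Nts'].
case/negP: Nts'; move: Dt Nts; rewrite hecke_oprE; case: ifP => [_ Dt _|_ ->].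
  by rewrite /s' -Dt mulgA tperm2 mul1g eqxx.
by rewrite eqxx.
Qed.

Definition groth_gen (x z : 'I_n.+1 -> P) : H :=
  incprod ngen n 0 (ext z) * decprod ngen n 0 (ext x).

Lemma ngen_prod_inv (a : seq nat) s :
  (size a < inversions s)%N -> (\prod_(j <- a) ngen j) s = 0.
Proof.
elim: a s => [|j a IHa] s lt_as.
  rewrite big_nil ma_1E; case: eqP => // s1.
  by rewrite s1 inversions1 in lt_as.
rewrite big_cons; case: ngenP => [i _|_]; last by rewrite mul0r ffunE.
rewrite gen_mulE big1 // => t /eqP Dt; apply: IHa.
by rewrite -ltnS (leq_trans lt_as) // -Dt inversions_op.
Qed.

(** By [ngen_prod_inv] a term of the expansion that omits a letter is too short to reach [s], so
    only the term using all letters contributes. *)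
Lemma hfac_prod_inv (l : seq (P * nat)) s : (size l <= inversions s)%N ->
  (\prod_(p <- l) hfac p.1 (ngen p.2)) s
    = (\prod_(p <- l) p.1) * (\prod_(p <- l) ngen p.2) s.
Proof.
elim: l s => [|[c j] l IHl] s le_ls; first by rewrite !big_nil mul1r.
rewrite !big_cons /hfac mulrDl mul1r -scalerAl ma_addE ma_scaleE /=.
rewrite IHl; last exact: ltnW.
have -> : (\prod_(p <- l) ngen p.2) s = 0.
  by rewrite -(big_map snd xpredT) ngen_prod_inv ?size_map.
rewrite mulr0 add0r -mulrA; congr (_ * _).
case: ngenP => [i _|_]; last by rewrite !mul0r !ffunE mulr0.
rewrite !gen_mulE mulr_sumr; apply: eq_bigr => t /eqP Dt; apply: IHl.
by rewrite -ltnS (leq_trans le_ls) // -Dt inversions_op.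
Qed.

Lemma all_decword d k m : (k + d <= m)%N -> all (fun j => j < m)%N (decword d k).
Proof.
elim: d k => //= d IHd k; rewrite addnS -addSn => le_m.
by rewrite all_rcons IHd // andbT (leq_trans _ le_m) // ltnS leq_addr.
Qed.

Lemma all_stairword d k m : (k + d <= m)%N -> all (fun j => j < m)%N (stairword d k).
Proof.
elim: d k => // d IHd k le_m; rewrite all_cat all_decword // IHd //.
by rewrite addSnnS.
Qed.

Lemma size_decword d k : size (decword d k) = d.
Proof. by elim: d k => //= d IHd k; rewrite size_rcons IHd. Qed.

Lemma size_stairword d k : size (stairword d k) = (\sum_(i < d.+1) (d - i))%N.
Proof.
elim: d k => [|d IHd] k; first by rewrite big_ord1.
by rewrite size_cat size_decword IHd [RHS]big_ord_recl.
Qed.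

Lemma ngen_prod_delta (a : seq nat) : all (fun j => j < n)%N a ->
  exists s, \prod_(j <- a) ngen j = ma_delta hecke_law P s.
Proof.
elim: a => [_|j a IHa /andP[lt_jn /IHa[s Ds]]].
  by exists 1%g; rewrite big_nil.
exists (hecke_op (Ordinal lt_jn) s).
by rewrite big_cons Ds (ngenE (Ordinal lt_jn)) genM.
Qed.

Lemma ma_delta_inj : injective (ma_delta hecke_law P).
Proof.
move=> s t /ffunP/(_ s); rewrite !ffunE eqxx; case: eqP => // _ /eqP.
by rewrite oner_eq0.
Qed.

(** The product is a basis element that absorbs every generator on its left, which characterizes
    [w0] by [w0_eq]. *)
Lemma ngen_stairword : \prod_(j <- stairword n 0) ngen j = ma_delta hecke_law P (w0 n).
Proof.
have [s Ds] := ngen_prod_delta (all_stairword (leqnn (0 + n))).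
rewrite Ds; congr ma_delta; apply: w0_eq => i; apply: ma_delta_inj.
rewrite -genM -Ds -ngenE.
exact: (stairword_absorb ngen_idem ngen_braid ngen_comm 0 (ltn_ord i)).
Qed.

Fixpoint stairfac d m (t z : nat -> P) : seq (P * nat) :=
  if d is d'.+1
  then [seq (oplus (t m) (z (j - m)%N), j) | j <- decword d m] ++ stairfac d' m.+1 t z
  else [::].

Lemma stairfacE d m (t z : nat -> P) :
  [seq p.2 | p <- stairfac d m t z] = stairword d m.
Proof.
elim: d m => // d IHd m.
by rewrite /stairfac -/stairfac map_cat IHd -map_comp map_id.
Qed.

Lemma mixfacE d m x z :
  mixfac ngen d m x z = \prod_(j <- decword d m) hfac (oplus x (z j)) (ngen j).
Proof.
elim: d m => [|d IHd] m; first by rewrite big_nil.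
by rewrite mixfacS IHd /= -cats1 big_cat big_seq1.
Qed.

Lemma mixprodE d m (t z : nat -> P) :
  mixprod ngen d m t z = \prod_(p <- stairfac d m t z) hfac p.1 (ngen p.2).
Proof.
elim: d m => [|d IHd] m; first by rewrite big_nil.
by rewrite mixprodS IHd mixfacE [RHS]big_cat big_map.
Qed.

Lemma decword_prod (F : nat -> P) d m k :
  \prod_(j <- decword d (m + k)) F (j - m)%N = \prod_(k <= l < k + d) F l.
Proof.
elim: d k => [|d IHd] k; first by rewrite addn0 big_nil big_geq.
rewrite /= -cats1 big_cat big_seq1 -addnS IHd addKn /= mulrC.
by rewrite [RHS]big_ltn ?addSnnS // addnS ltnS leq_addr.
Qed.

Lemma stairfac_prod d m (t z : nat -> P) :
  \prod_(p <- stairfac d m t z) p.1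
    = \prod_(k < d.+1) \prod_(0 <= l < d - k) oplus (t (m + k)%N) (z l).
Proof.
elim: d m => [|d IHd] m; first by rewrite big_nil big_ord1 big_geq.
rewrite big_cat big_map IHd [RHS]big_ord_recl subn0; congr (_ * _).
  have := decword_prod (fun l => oplus (t m) (z l)) d.+1 m 0.
  by rewrite !addn0 add0n.
by apply: eq_bigr => k _; rewrite /= /bump addSnnS subSS.
Qed.

(** In the mixed form the number of factors equals the number of inversions of [w0], so
    [hfac_prod_inv] leaves the product of all parameters. *)
Lemma groth_gen_top x z : groth_gen x z (w0 n)
  = \prod_(k < n.+1) \prod_(l < n.+1 | (k.+1 + l.+1 <= n.+1)%N) oplus (x k) (z l).
Proof.
rewrite /groth_gen incprod_decprod; last first.
- exact: ngen_comm.
- exact: ngen_braid.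
- exact: ngen_idem.
rewrite mixprodE hfac_prod_inv; last first.
  by rewrite -(size_map snd) stairfacE size_stairword inversions_w0.
rewrite -(big_map snd xpredT) stairfacE ngen_stairword ffunE eqxx mulr1.
rewrite stairfac_prod; apply: eq_bigr => k _; rewrite add0n extE.
rewrite (big_nat_widen _ _ n.+1) ?(leq_trans (leq_subr _ _)) // big_mkord.
by apply: eq_big => [l | l _]; rewrite ?extE //=; have := ltn_ord k; lia.
Qed.

(** The anti-automorphism induced by inversion ([ma_revM]). It relates [decprod] to [incprod] and so
    accounts for the inverse in the sum over pairs. *)
Definition ma_rev (f : H) : H := [ffun s => f s^-1%g].

Lemma ma_revM f g : ma_rev (f * g) = ma_rev g * ma_rev f.
Proof.
apply/ffunP => s; rewrite ffunE !ma_mulE.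
have bijV : bijective (fun p : 'S_n.+1 * 'S_n.+1 => (p.2^-1, p.1^-1)%g).
  by exists (fun p => (p.2^-1, p.1^-1)%g) => -[t r] /=; rewrite !invgK.
rewrite (reindex _ (onW_bij _ bijV)); apply: eq_big => [p | p _] /=.
  by rewrite -[in LHS]hecke_mulV (inj_eq invg_inj).
by rewrite !ffunE mulrC.
Qed.

Lemma ma_rev_delta s : ma_rev (ma_delta hecke_law P s) = ma_delta hecke_law P s^-1%g.
Proof. by apply/ffunP => t; rewrite !ffunE -(inj_eq invg_inj) invgK. Qed.

Lemma ma_rev1 : ma_rev 1 = 1.
Proof. by rewrite [LHS]ma_rev_delta invg1. Qed.

Lemma ma_rev_hfac x j : ma_rev (hfac x (ngen j)) = hfac x (ngen j).
Proof.
have revD f g : ma_rev (f + g) = ma_rev f + ma_rev g.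
  by apply/ffunP => s; rewrite !ffunE.
have revZ y f : ma_rev (y *: f) = y *: ma_rev f.
  by apply/ffunP => s; rewrite !ffunE.
rewrite revD revZ ma_rev1; congr (_ + _ *: _); case: ngenP => [i _|_].
  by rewrite ma_rev_delta tpermV.
by apply/ffunP => s; rewrite !ffunE.
Qed.

Lemma ma_rev_decfac d k x : ma_rev (decfac ngen d k x) = incfac ngen d k x.
Proof.
elim: d k => [|d IHd] k; first exact: ma_rev1.
by rewrite decfacS ma_revM IHd ma_rev_hfac.
Qed.

Lemma ma_rev_decprod d k z : ma_rev (decprod ngen d k z) = incprod ngen d k z.
Proof.
elim: d k => [|d IHd] k; first exact: ma_rev1.
by rewrite decprodS ma_revM IHd ma_rev_decfac.
Qed.
End HeckeAlgebra.

Section HeckeAlgebraMap.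
Variables (n : nat) (P Q : comNzRingType) (phi : {rmorphism P -> Q}).
Local Notation map := (ma_map (op := hecke_law n) phi).

Lemma map_hfac x j : map (hfac x (ngen n P j)) = hfac (phi x) (ngen n Q j).
Proof.
rewrite /ngen; case: insub => [i|]; first exact: ma_map_hfac.
by rewrite /hfac !scaler0 !addr0 ma_map1.
Qed.

Lemma map_decfac d k x : map (decfac (ngen n P) d k x) = decfac (ngen n Q) d k (phi x).
Proof.
elim: d k => [|d IHd] k; first exact: ma_map1.
by rewrite !decfacS ma_mapM IHd map_hfac.
Qed.

Lemma map_incfac d k x : map (incfac (ngen n P) d k x) = incfac (ngen n Q) d k (phi x).
Proof.
elim: d k => [|d IHd] k; first exact: ma_map1.
by rewrite !incfacS ma_mapM IHd map_hfac.
Qed.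

Lemma map_decprod d k z :
  map (decprod (ngen n P) d k z) = decprod (ngen n Q) d k (phi \o z).
Proof.
elim: d k => [|d IHd] k; first exact: ma_map1.
by rewrite !decprodS ma_mapM IHd map_decfac.
Qed.

Lemma map_incprod d k z :
  map (incprod (ngen n P) d k z) = incprod (ngen n Q) d k (phi \o z).
Proof.
elim: d k => [|d IHd] k; first exact: ma_map1.
by rewrite !incprodS ma_mapM IHd map_incfac.
Qed.

Lemma comp_ext (x : 'I_n.+1 -> P) : phi \o ext x =1 ext (phi \o x).
Proof.
by move=> k; rewrite /ext /=; case: insub => [i|] //=; rewrite rmorph0.
Qed.
End HeckeAlgebraMap.

(** * Swapping two neighbouring x variables in the generating series *)

Section GrothSwap.
Variables (n : nat) (P : comNzRingType) (phi : {rmorphism P -> P}) (i : 'I_n).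
Variables (x z : 'I_n.+1 -> P).
Hypothesis phi_x : forall k, phi (x k) = x (tperm (lo i) (hi i) k).
Hypothesis phi_z : forall k, phi (z k) = z k.
Implicit Type s : 'S_n.+1.
Local Notation F := (groth_gen x z).

Lemma groth_gen_swap : F * hfac (x (hi i)) (gen P i)
  = ma_map (op := hecke_law n) phi F * hfac (x (lo i)) (gen P i).
Proof.
rewrite /groth_gen ma_mapM map_incprod map_decprod.
rewrite (@eq_incprod _ _ _ n 0 (phi \o ext z) (ext z)); last first.
  by move=> k; rewrite comp_ext /ext; case: insub => //= k'; rewrite phi_z.
have xlo : x (lo i) = ext x i by rewrite -(extE x).
have xhi : x (hi i) = ext x i.+1 by rewrite -(extE x).
rewrite -2!(mulrA (incprod _ _ _ _)) -ngenE xlo xhi; congr (_ * _).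
apply: decprod_exchange => //; rewrite ?add0n //.
- exact: ngen_idem.
- exact: ngen_braid.
- exact: ngen_comm.
- by rewrite /= -xlo -xhi phi_x tpermL.
- by rewrite /= -xlo -xhi phi_x tpermR.
move=> j Nlo Nhi; rewrite comp_ext /ext; case: insubP => //= k _ Dk.
by rewrite phi_x tpermD // -val_eqE /= ?Dk eq_sym.
Qed.

(** Compare the coefficients of [s] in [groth_gen_swap]: at an ascent the terms containing [gen P i]
    vanish. *)
Lemma groth_gen_asc s : (s (lo i) < s (hi i))%N -> phi (F s) = F s.
Proof.
move=> asc_s; have := congr1 (fun f : monoid_alg (hecke_law n) P => f s) groth_gen_swap.
rewrite /= /hfac !mulrDr !mulr1 -!scalerAr !ma_addE !ma_scaleE.
by rewrite !gen_mulrE_asc // !mulr0 !addr0 ma_mapE => <-.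
Qed.

(** The coefficient of [s] in [groth_gen_swap], solved for [F s'], which is symmetric by
    [groth_gen_asc]. The right-hand side is the numerator of the isobaric divided difference of
    [F s]. *)
Lemma groth_gen_desc s (s' := (tperm (lo i) (hi i) * s)%g) :
    (s (hi i) < s (lo i))%N ->
  F s' * (x (lo i) - x (hi i))
    = F s - phi (F s) + (x (hi i) * F s - phi (x (hi i) * F s)).
Proof.
move=> desc_s; have phiF : phi (F s') = F s'.
  by apply: groth_gen_asc; rewrite !permM tpermL tpermR.
have := congr1 (fun f : monoid_alg (hecke_law n) P => f s) groth_gen_swap.
rewrite /= /hfac !mulrDr !mulr1 -!scalerAr !ma_addE !ma_scaleE.
rewrite !gen_mulrE_desc // !ma_mapE -/s' phiF rmorphM phi_x tpermR.
move: (F s) (phi _) (F s') (x _) (x _) => f g h a b.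
move=> eq_fg.
have -> : f - g + (b * f - a * g)
    = (f + b * (f + h)) - (g + a * (g + h)) + h * (a - b) by ring.
by rewrite eq_fg subrr add0r mulrDr.
Qed.
End GrothSwap.

(** * Isobaric divided differences *)

Section Isobaric.
Variable n : nat.
Local Notation polyxy := {mpoly int[n.+1 + n.+1]}.
Implicit Types (i : 'I_n) (f g : polyxy) (s : 'S_n.+1).
Local Notation X k := ('X_(xvar k) : polyxy).
Local Notation Y k := ('X_(yvar k) : polyxy).

Definition swapx_morph i : {rmorphism polyxy -> polyxy} :=
  msym (tperm (xvar (lo i)) (xvar (hi i))).

Lemma swapx_var i k : swapx i 'X_k = 'X_(tperm (xvar (lo i)) (xvar (hi i)) k).
Proof. by rewrite /swapx /msym mmapX mmap1U. Qed.

Lemma swapx_x i k : swapx i (X k) = X (tperm (lo i) (hi i) k).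
Proof.
rewrite swapx_var; congr 'X_(_).
by rewrite /xvar (inj_tperm _ _ _ (@lshift_inj _ _)).
Qed.

Lemma swapx_y i k : swapx i (Y k) = Y k.
Proof. by rewrite swapx_var tpermD // /xvar /yvar eq_lrshift. Qed.

Lemma Xlo_neq_Xhi i : X (lo i) - X (hi i) != 0.
Proof.
apply/eqP => /(congr1 (meval (fun k => (k == xvar (lo i))%:R)))/eqP.
rewrite rmorphB rmorph0 /= !mevalXU eqxx eq_lshift [hi i == _]eq_sym.
by rewrite (negPf (lo_neq_hi i)) subr0 oner_eq0.
Qed.

Lemma divdiffE i f : divdiff i f * (X (lo i) - X (hi i)) = f - swapx i f.
Proof. exact/eqP/(xchooseP (divdiffP i f)). Qed.

Lemma isobaric_unique i f g :
    g * (X (lo i) - X (hi i)) =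
      f - swapx i f + (X (hi i) * f - swapx i (X (hi i) * f)) ->
  isobaric i f = g.
Proof.
move=> Dg; apply: (mulIf (Xlo_neq_Xhi i)).
by rewrite Dg /isobaric mulrDl !divdiffE.
Qed.

Lemma isobaric_groth_gen i (z : 'I_n.+1 -> polyxy) s
    (F := groth_gen (fun k => X k) z) :
    (forall k, swapx i (z k) = z k) -> (s (hi i) < s (lo i))%N ->
  isobaric i (F s) = F (tperm (lo i) (hi i) * s)%g.
Proof.
move=> fix_z desc_s; apply: isobaric_unique.
exact: (@groth_gen_desc _ _ (swapx_morph i) i _ z (swapx_x i) fix_z s desc_s).
Qed.

(** In a reduced word each letter is an ascent of the inverse of the part after it, hence a descent
    once [w0] is applied, as [isobaric_groth_gen] requires. The result depends only on the
    permutation, so the choice of the reduced word is harmless. *)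
Lemma isobaric_word_groth_gen (z : 'I_n.+1 -> polyxy) (a : seq 'I_n)
    (F := groth_gen (fun k => X k) z) :
    (forall i k, swapx i (z k) = z k) -> reduced a ->
  foldr (@isobaric n) (F (w0 n)) a = F ((word_perm a)^-1 * w0 n)%g.
Proof.
move=> fix_z; elim: a => [|i a IHa] red_a; first by rewrite /= invg1 mul1g.
rewrite /= (IHa (reduced_behead red_a)) isobaric_groth_gen //.
  by rewrite invMg tpermV mulgA.
have := reduced_ascent red_a; rewrite !permM ![w0 n _]permE /=.
by have := ltn_ord ((word_perm a)^-1%g (hi i)); lia.
Qed.

Lemma isobaric_perm_groth_gen (z : 'I_n.+1 -> polyxy) s
    (F := groth_gen (fun k => X k) z) :
    (forall i k, swapx i (z k) = z k) ->
  isobaric_perm (w0 n * s^-1)%g (F (w0 n)) = F s.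
Proof.
move=> fix_z; rewrite /isobaric_perm isobaric_word_groth_gen //.
  by rewrite reduced_wordE invMg invgK mulgKV.
exact: reduced_reduced_word.
Qed.

Lemma double_grothE s :
  double_groth s = groth_gen (fun k => X k) (fun k => Y k) s.
Proof.
rewrite -isobaric_perm_groth_gen => [|i k]; last exact: swapx_y.
by rewrite groth_gen_top.
Qed.

(** Put [z = 0]: the increasing half becomes 1, and [oplus x 0 = x] turns the coefficient of [w0]
    into the staircase monomial. *)
Lemma single_grothE s :
  single_groth s = decprod (ngen n polyxy) n 0 (ext (fun k => X k)) s.
Proof.
have inc1 d m : incprod (ngen n polyxy) d m (fun=> 0) = 1.
  elim: d m => // d IHd m; rewrite incprodS IHd mul1r.
  move: m; elim: d.+1 => // d' IHd' m.
  by rewrite incfacS IHd' hfac0 mul1r.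
transitivity (groth_gen (fun k => X k) (fun=> 0) s).
  rewrite -isobaric_perm_groth_gen => [|i k]; last exact: rmorph0.
  rewrite groth_gen_top; congr isobaric_perm; apply: eq_bigr => k _.
  under eq_bigr do rewrite /oplus mulr0 !addr0.
  rewrite prodr_const; congr (_ ^+ _).
  rewrite -sum1_card (eq_bigl (fun l : 'I_n.+1 => (l < n - k)%N)) => [|l].
    rewrite -(big_ord_widen n.+1 (fun=> 1%N)) ?sum_nat_const ?card_ord ?muln1 //.
    by rewrite (leq_trans (leq_subr _ _)).
  by rewrite unfold_in; have := ltn_ord k; lia.
rewrite /groth_gen; have -> : incprod (ngen n polyxy) n 0 (ext (fun=> 0)) = 1.
  transitivity (incprod (ngen n polyxy) n 0 (fun=> 0)); last exact: inc1.
  by apply: eq_incprod => k; rewrite /ext; case: insub.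
by rewrite mul1r.
Qed.
End Isobaric.

(** * Expansion over factorizations *)

Section Subsequences.
Variables (T : eqType) (lt : rel T).
Implicit Types (r h : seq T).

Fixpoint subseqs r : seq (seq T) :=
  if r is a :: r' then subseqs r' ++ [seq a :: h | h <- subseqs r'] else [:: [::]].

Lemma mem_subseqs r h : (h \in subseqs r) = subseq h r.
Proof.
elim: r h => [|a r IHr] h /=; first by rewrite inE.
rewrite mem_cat IHr; case: h => [|b h] /=; first by rewrite sub0seq.
case: (b =P a) => [->|Nba].
  rewrite mem_map ?IHr; last by move=> ? ? [].
  by apply: orb_idl; apply: subseq_trans; apply: subseq_cons.
by rewrite (introF mapP) ?orbF // => -[h' _ [/Nba]].
Qed.

Lemma uniq_subseqs r : uniq r -> uniq (subseqs r).
Proof.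
elim: r => //= a r IHr /andP[ar ur]; rewrite cat_uniq IHr //=.
rewrite map_inj_uniq ?IHr //; last by move=> ? ? [].
rewrite andbT; apply/hasPn => _ /mapP[h _ ->]; rewrite /= mem_subseqs.
by apply: contra ar => /mem_subseq-> //; rewrite mem_head.
Qed.

(** A strictly sorted sequence is determined by its elements, so [h] is [r] filtered by membership
    in [h]. This turns the choices made in expanding a product into sorted factors. *)
Lemma sorted_subseqE r h : transitive lt -> irreflexive lt -> sorted lt r ->
  subseq h r = sorted lt h && all (mem r) h.
Proof.
move=> lt_tr lt_irr sr; apply/idP/andP => [sub_h | [sh /allP hr]].
  by split; [apply: subseq_sorted sub_h sr | apply/allP/mem_subseq].
have -> : h = [seq a <- r | a \in h].
  apply: (irr_sorted_eq lt_tr lt_irr) => // [|a].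
    exact: sorted_filter.
  by rewrite mem_filter; case: (boolP (a \in h)) => // /hr ar; apply/esym.
exact: filter_subseq.
Qed.
End Subsequences.

Section Expansion.
Variables (P : comNzRingType) (A : algType P) (T : finType).
Implicit Types (V : T -> A).

Lemma prod_hfac_subseqs (c : T -> P) V (r : seq T) :
  \prod_(a <- r) hfac (c a) (V a)
    = \sum_(h <- subseqs r) (\prod_(a <- h) c a) *: \prod_(a <- h) V a.
Proof.
elim: r => [|a r IHr]; first by rewrite big_seq1 !big_nil scale1r.
rewrite big_cons IHr big_cat big_map /= /hfac mulrDl mul1r; congr (_ + _).
rewrite mulr_sumr; apply: eq_bigr => h _.
by rewrite !big_cons -scalerAl -scalerAr scalerA.
Qed.

Lemma prod_hfac_sorted (lt : rel T) (c : T -> P) V (r : seq T) N :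
    transitive lt -> irreflexive lt -> sorted lt r -> (size r <= N)%N ->
  \prod_(a <- r) hfac (c a) (V a)
    = \sum_(h : N.-bseq T | sorted lt h && all (mem r) h)
        (\prod_(a <- h) c a) *: \prod_(a <- h) V a.
Proof.
move=> lt_tr lt_irr sr szr; rewrite prod_hfac_subseqs.
rewrite -(big_map (val : N.-bseq T -> seq T)
  (fun h => sorted lt h && all (mem r) h)
  (fun h => (\prod_(a <- h) c a) *: \prod_(a <- h) V a)).
rewrite -[RHS]big_filter; apply: perm_big; apply: uniq_perm.
- exact/uniq_subseqs/(sorted_uniq lt_tr lt_irr).
- by rewrite filter_uniq // map_inj_uniq ?index_enum_uniq //; apply: val_inj.
move=> h; rewrite mem_subseqs mem_filter (sorted_subseqE _ lt_tr lt_irr sr).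
apply/idP/idP => [sh|/andP[] //]; rewrite sh /=.
have sub_h : subseq h r by rewrite (sorted_subseqE _ lt_tr lt_irr sr).
have szh : (size h <= N)%N := leq_trans (size_subseq sub_h) szr.
by apply/mapP; exists (Bseq szh); rewrite ?mem_index_enum.
Qed.

Lemma prod_sum_tuple m (J : finType) (Q : 'I_m -> pred J) (F : 'I_m -> J -> A) :
  \prod_(p < m) \sum_(j | Q p j) F p j
    = \sum_(f : m.-tuple J | [forall p, Q p (tnth f p)])
        \prod_(p < m) F p (tnth f p).
Proof.
rewrite bigA_distr_big_dep.
have bijF : bijective (fun f : m.-tuple J => [ffun p => tnth f p]).
  exists (fun f : {ffun 'I_m -> J} => [tuple f p | p < m]) => f.
    by apply: eq_from_tnth => p; rewrite tnth_mktuple ffunE.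
  by apply/ffunP => p; rewrite ffunE tnth_mktuple.
rewrite (reindex _ (onW_bij _ bijF)); apply: eq_big => f.
  by apply/familyP/forallP => H p; have := H p; rewrite ffunE.
by move=> _; apply: eq_bigr => p _; rewrite ffunE.
Qed.
End Expansion.

(** * The product forms as blocks, one for each factor of a factorization *)

Section Factorizations.
Variables (n : nat) (P : comNzRingType).

Lemma prod_genE (a : seq 'I_n) (w : 'S_n.+1) :
  (\prod_(i <- a) gen P i) w = (represents a w)%:R.
Proof.
rewrite /represents eq_sym; suff -> : \prod_(i <- a) gen P i
    = ma_delta (hecke_law n) P (foldr (@hecke_op n) 1%g a) by rewrite ffunE.
by elim: a => [|i a IHa]; rewrite ?big_nil ?big_cons //= IHa genM.
Qed.

(** The common source of both factorization formulas: block [p] has the alphabet [r p], ordered by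
    [lt p], and the weights [c p], while [e] forgets circles. *)
Lemma coef_prod_hfac m (T : finType) (N : nat) (lt : 'I_m -> rel T)
    (r : 'I_m -> seq T) (e : T -> 'I_n) (c : 'I_m -> T -> P) (w : 'S_n.+1) :
    (forall p, [/\ transitive (lt p), irreflexive (lt p),
                   sorted (lt p) (r p) & (size (r p) <= N)%N]) ->
  (\prod_(p < m) \prod_(a <- r p) hfac (c p a) (gen P (e a))) w
    = \sum_(f : m.-tuple (N.-bseq T)
            | represents [seq e a | a <- flatten [seq val h | h <- f]] w
              && [forall p, sorted (lt p) (tnth f p)
                            && all (mem (r p)) (tnth f p)])
        \prod_(p < m) \prod_(a <- tnth f p) c p a.
Proof.
move=> lt_r; rewrite (eq_bigr (fun p => \sum_(h : N.-bseq T
    | sorted (lt p) h && all (mem (r p)) h)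
  (\prod_(a <- h) c p a) *: \prod_(a <- h) gen P (e a))) => [|p _]; last first.
  by have [*] := lt_r p; apply: prod_hfac_sorted.
rewrite prod_sum_tuple ma_sumE [RHS]big_mkcond [LHS]big_mkcond.
apply: eq_bigr => f _; rewrite andbC; case: forallP => //= _.
have -> : \prod_(p < m) ((\prod_(a <- tnth f p) c p a)
      *: \prod_(a <- tnth f p) gen P (e a))
    = (\prod_(p < m) \prod_(a <- tnth f p) c p a)
      *: \prod_(i <- [seq e a | a <- flatten [seq val h | h <- f]]) gen P i.
  rewrite big_map big_flatten big_map big_tuple; elim/big_rec3: _ => [|p x y z _ ->].
    by rewrite scale1r.
  by rewrite -scalerAl -scalerAr scalerA.
by rewrite ma_scaleE prod_genE; case: ifP; rewrite ?mulr1 ?mulr0.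
Qed.

Definition letters (k : nat) : seq 'I_n := [seq i : 'I_n <- enum 'I_n | (k <= i)%N].

Lemma mem_letters k i : (i \in letters k) = (k <= i)%N.
Proof. by rewrite mem_filter mem_enum andbT. Qed.

Lemma val_letters k : map val (letters k) = iota k (n - k).
Proof.
have -> : map val (letters k) = [seq j <- iota 0 n | (k <= j)%N].
  by rewrite -val_enum_ord filter_map.
apply: (irr_sorted_eq ltn_trans ltnn).
- exact/sorted_filter/iota_ltn_sorted/ltn_trans.
- exact: iota_ltn_sorted.
by move=> j; rewrite mem_filter !mem_iota /=; lia.
Qed.

Lemma sorted_letters k : sorted (fun i j : 'I_n => i < j)%N (letters k).
Proof.
by have := iota_ltn_sorted k (n - k); rewrite -val_letters sorted_map.
Qed.

Lemma size_letters k : size (letters k) = (n - k)%N.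
Proof. by rewrite -(size_map val) val_letters size_iota. Qed.

Lemma decwordE d k : decword d k = rev (iota k d).
Proof. by elim: d k => //= d IHd k; rewrite IHd rev_cons. Qed.

Lemma decword_letters k : decword (n - k) k = map val (rev (letters k)).
Proof. by rewrite decwordE map_rev val_letters. Qed.

Lemma decfac_letters k x :
  decfac (ngen n P) (n - k) k x = \prod_(i <- rev (letters k)) hfac x (gen P i).
Proof.
have E d m : decfac (ngen n P) d m x = \prod_(j <- decword d m) hfac x (ngen n P j).
  elim: d m => [|d IHd] m; first by rewrite big_nil.
  by rewrite decfacS IHd /= -cats1 big_cat big_seq1.
by rewrite E decword_letters big_map; apply: eq_bigr => i _; rewrite ngenE.
Qed.

Lemma incfac_letters k x :
  incfac (ngen n P) (n - k) k x = \prod_(i <- letters k) hfac x (gen P i).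
Proof.
have E d m : incfac (ngen n P) d m x = \prod_(j <- iota m d) hfac x (ngen n P j).
  elim: d m => [|d IHd] m; first by rewrite big_nil.
  by rewrite incfacS IHd /= big_cons.
by rewrite E -val_letters big_map; apply: eq_bigr => i _; rewrite ngenE.
Qed.

Lemma decprod_blocks (x : 'I_n.+1 -> P) : decprod (ngen n P) n 0 (ext x)
  = \prod_(k < n.+1) \prod_(i <- rev (letters k)) hfac (x k) (gen P i).
Proof.
(* The block [k = d] is [decfac] of length 0, that is 1; it stands for the last of the n + 1
   factors, for which no letter is large enough. *)
have E d m z : decprod (ngen n P) d m z
    = \prod_(k < d.+1) decfac (ngen n P) (d - k) (m + k) (z (m + k)%N).
  elim: d m => [|d IHd] m; first by rewrite big_ord1.
  rewrite decprodS IHd [RHS]big_ord_recl addn0 subn0; congr (_ * _).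
  by apply: eq_bigr => k _; rewrite lift0 addnS -addSn subSS.
by rewrite E; apply: eq_bigr => k _; rewrite !add0n extE decfac_letters.
Qed.

Lemma incprod_blocks (z : 'I_n.+1 -> P) : incprod (ngen n P) n 0 (ext z)
  = \prod_(k < n.+1) \prod_(i <- letters (rev_ord k)) hfac (z (rev_ord k)) (gen P i).
Proof.
have E d m t : incprod (ngen n P) d m t
    = \prod_(k < d.+1) incfac (ngen n P) k (m + (d - k)) (t (m + (d - k))%N).
  elim: d m => [|d IHd] m; first by rewrite big_ord1.
  rewrite incprodS IHd [RHS]big_ord_recr /= subnn addn0; congr (_ * _).
  apply: eq_bigr => k _; rewrite subSn ?addnS -?addSn //.
  by rewrite -ltnS.
rewrite E; apply: eq_bigr => k _; rewrite add0n.
have Dk : rev_ord k = (n - k)%N :> nat by rewrite /= subSS.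
rewrite -Dk extE -incfac_letters Dk subKn //.
by rewrite -ltnS.
Qed.

(** The left factors are numbered outward from the center but listed from left to right, hence
    [rev_ord] here and in [dcoef]. *)
Definition dletters (p : 'I_(n.+1 + n.+1)) : seq 'I_n :=
  match split p with
  | inl k => letters (rev_ord k)
  | inr k => rev (letters k)
  end.

Definition dcoef (x z : 'I_n.+1 -> P) (p : 'I_(n.+1 + n.+1)) : P :=
  match split p with inl k => z (rev_ord k) | inr k => x k end.

Definition dlt (p : 'I_(n.+1 + n.+1)) (i j : 'I_n) : bool :=
  match split p with inl _ => i < j | inr _ => j < i end%N.

Lemma split_lshift (k : 'I_n.+1) : split (lshift n.+1 k) = inl k.
Proof. exact: (unsplitK (inl k)). Qed.

Lemma split_rshift (k : 'I_n.+1) : split (rshift n.+1 k) = inr k.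
Proof. exact: (unsplitK (inr k)). Qed.

Lemma groth_gen_blocks (x z : 'I_n.+1 -> P) : groth_gen x z
  = \prod_(p < n.+1 + n.+1) \prod_(a <- dletters p) hfac (dcoef x z p) (gen P a).
Proof.
rewrite /groth_gen incprod_blocks decprod_blocks [RHS]big_split_ord /=.
congr (_ * _); apply: eq_bigr => k _.
  by rewrite /dletters /dcoef split_lshift.
by rewrite /dletters /dcoef split_rshift.
Qed.

Lemma dlettersP p : [/\ transitive (dlt p), irreflexive (dlt p),
  sorted (dlt p) (dletters p) & (size (dletters p) <= n)%N].
Proof.
rewrite /dlt /dletters; case: split => k.
  rewrite size_letters leq_subr; split=> [a b d|a||//]; last exact: sorted_letters.
    exact: ltn_trans.
  exact: ltnn.
rewrite size_rev size_letters leq_subr rev_sorted; split=> [a b d ab da|a||//].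
- exact: ltn_trans ab.
- exact: ltnn.
- exact: sorted_letters.
Qed.

Definition cletters (k : nat) : seq (cletter n) :=
  flatten [seq [:: (i, false); (i, true)] | i <- rev (letters k)].

Lemma mem_cletters k a : (a \in cletters k) = (k <= a.1)%N.
Proof.
case: a => i b; apply/flatten_mapP/idP => [[j] | le_ki].
  by rewrite mem_rev mem_letters !inE !xpair_eqE => le_kj /orP[] /andP[/eqP->].
by exists i; rewrite ?mem_rev ?mem_letters // !inE !xpair_eqE eqxx; case: (b).
Qed.

Lemma size_cletters k : size (cletters k) = (n - k).*2.
Proof.
rewrite /cletters -(size_letters k) -(size_rev (letters k)).
elim: (rev _) => //= i s IHs.
by rewrite IHs.
Qed.

Definition cgt : rel (cletter n) := fun a b => (crank b.1 b.2 < crank a.1 a.2)%N.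

Lemma sorted_cletters k : sorted cgt (cletters k).
Proof.
have : sorted (fun i j : 'I_n => j < i)%N (rev (letters k)).
  by rewrite rev_sorted sorted_letters.
rewrite /cletters; elim: (rev _) => //= i [_ _|j s IHs /= /andP[lt_ji sj]].
  by rewrite /= /cgt /crank /= andbT addn0 addn1.
rewrite /= in IHs *; rewrite IHs // !andbT /cgt /crank /=; lia.
Qed.

Definition ccoef (x z : 'I_n.+1 -> P) (k : nat) (a : cletter n) : P :=
  if a.2 then ext z (a.1 - k) else ext x k.

(** Each factor splits by [hfacM] as h_j(x_k (+) y) = h_j(x_k) h_j(y), the uncircled letter followed
    by the circled one, as the decreasing order demands. *)
Lemma mixprod_blocks (x z : 'I_n.+1 -> P) : mixprod (ngen n P) n 0 (ext x) (ext z)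
  = \prod_(k < n.+1) \prod_(a <- cletters k) hfac (ccoef x z k a) (gen P a.1).
Proof.
have E d m t : mixprod (ngen n P) d m t (ext z)
    = \prod_(k < d.+1) mixfac (ngen n P) (d - k) (m + k) (t (m + k)%N)
                          (fun j => ext z (j - (m + k))).
  elim: d m => [|d IHd] m; first by rewrite big_ord1.
  rewrite mixprodS IHd [RHS]big_ord_recl addn0 subn0; congr (_ * _).
  by apply: eq_bigr => k _; rewrite lift0 addnS -addSn subSS.
rewrite E; apply: eq_bigr => k _; rewrite !add0n mixfacE decword_letters.
rewrite big_map /cletters big_flatten big_map; apply: eq_bigr => i _.
rewrite big_cons big_seq1 /ccoef /= -hfacM ?ngenE //.
by rewrite -ngenE ngen_idem.
Qed.
End Factorizations.

(** * The three formulas *)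

Section Monomials.
Variable n : nat.
Local Notation polyxy := {mpoly int[n.+1 + n.+1]}.
Local Notation X k := ('X_(xvar k) : polyxy).
Local Notation Y k := ('X_(yvar k) : polyxy).

Lemma ext_prod (P : comNzRingType) (z : 'I_n.+1 -> P) (j : nat) : (j <= n)%N ->
  ext z j = \prod_(l < n.+1) z l ^+ (l == j :> nat).
Proof.
move=> le_jn; pose k : 'I_n.+1 := Ordinal (n := n.+1) le_jn.
rewrite -[j]/(val k) extE (bigD1 k) //= eqxx expr1 big1 ?mulr1 // => l.
by rewrite -val_eqE /= => /negPf->.
Qed.

Lemma cxymonomialE (f : cfactorization n) :
    (forall k : 'I_n.+1, all (mem (cletters n k)) (tnth f k)) ->
  \prod_(k < n.+1) \prod_(a <- tnth f k) ccoef (fun k => X k) (fun k => Y k) k a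
    = xymonomial (cxwt f) (cywt f).
Proof.
move=> f_bound; rewrite /xymonomial.
under [Z in _ = _ * Z]eq_bigr do rewrite /cywt expr_sum.
rewrite [Z in _ = _ * Z]exchange_big -big_split; apply: eq_bigr => k _ /=.
rewrite /cxwt; elim: (val (tnth f k)) (f_bound k) => [_|[i b] h IHh /andP[le_ki hk]].
  by rewrite big_nil expr0 mul1r big1.
rewrite big_cons IHh //= exprD /ccoef /=.
(* The bound makes the truncated difference [i - k] exact, so that [l = i - k] is the condition
   [i = l + k] of [cywt]. *)
have {}le_ki : (k <= i)%N by rewrite -(mem_cletters k (i, b)).
under [Z in _ = _ * Z]eq_bigr do rewrite exprD.
rewrite big_split /= [RHS]mulrACA; congr (_ * _); case: b => /=.
  rewrite mul1r ext_prod; last by rewrite (leq_trans (leq_subr _ _)) // ltnW.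
  by apply: eq_bigr => l _; congr (_ ^+ _); congr nat_of_bool; apply/eqP/eqP; lia.
by rewrite extE big1 ?mulr1.
Qed.

Lemma double_groth_circled (w : 'S_n.+1) :
  double_groth w = \sum_(f in bounded_circled w) xymonomial (cxwt f) (cywt f).
Proof.
rewrite double_grothE /groth_gen incprod_decprod; last first.
- exact: ngen_comm.
- exact: ngen_braid.
- exact: ngen_idem.
rewrite mixprod_blocks (coef_prod_hfac (N := n.*2) (lt := fun=> @cgt n)); last first.
  move=> k; split; [|by move=> a; apply: ltnn| exact: sorted_cletters |].
    by move=> a b c ba cb; apply: ltn_trans ba.
  by rewrite size_cletters leq_double leq_subr.
apply: eq_big => [f | f /andP[_ /forallP bf]]; last first.
  by apply: cxymonomialE => k; have /andP[] := bf k.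
rewrite inE; congr (_ && _); apply/forallP/andP => [bf | [/forallP sf /forallP bf] k].
  split; apply/forallP => k; have /andP[// _ /allP bk] := bf k.
  by apply/allP => -[i []] /bk; rewrite /= mem_cletters /crank /=; lia.
rewrite sf; apply/allP => -[i b] /(allP (bf k)).
by rewrite /= mem_cletters /crank /=; case: b; lia.
Qed.

Lemma double_groth_double (w : 'S_n.+1) :
  double_groth w = \sum_(f in bounded_double w) xymonomial (dxwt f) (dywt f).
Proof.
rewrite double_grothE groth_gen_blocks.
pose c (p : 'I_(n.+1 + n.+1)) (_ : 'I_n) := dcoef (fun k => X k) (fun k => Y k) p.
rewrite (coef_prod_hfac id c w (@dlettersP n)) {}/c.
apply: eq_big => [f | f _]; last first.
  rewrite big_split_ord /= mulrC /xymonomial; congr (_ * _).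
    apply: eq_bigr => k _; rewrite /dcoef split_rshift big_const_seq count_predT.
    by rewrite -Monoid.iteropE.
  (* The left half meets the y variables in the order n, ..., 0. *)
  rewrite [RHS](reindex_inj rev_ord_inj).
  apply: eq_bigr => k _; rewrite /dcoef split_lshift big_const_seq count_predT.
  by rewrite -Monoid.iteropE /dywt /left_factor rev_ordK.
have all_lettersE k (h : seq 'I_n) :
    all (mem (letters n k)) h = all (fun a : 'I_n => k <= a)%N h.
  by apply: eq_all => a; rewrite /= mem_letters.
have left_ok k : sorted (dlt (lshift n.+1 (rev_ord k))) (left_factor f k)
      && all (mem (dletters (lshift n.+1 (rev_ord k)))) (left_factor f k)
    = sorted (fun a b : 'I_n => a < b)%N (left_factor f k)
      && all (fun a : 'I_n => k <= a)%N (left_factor f k).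
  by rewrite /dlt /dletters split_lshift rev_ordK all_lettersE.
have right_ok k : sorted (dlt (rshift n.+1 k)) (right_factor f k)
      && all (mem (dletters (rshift n.+1 k))) (right_factor f k)
    = sorted (fun a b : 'I_n => b < a)%N (right_factor f k)
      && all (fun a : 'I_n => k <= a)%N (right_factor f k).
  rewrite /dlt /dletters split_rshift -all_lettersE; congr (_ && _).
  by apply: eq_all => a; rewrite /= mem_rev.
rewrite inE map_id; congr (_ && _).
apply/forallP/and3P => [bf | [/forallP lf /forallP rf /forallP bf] p].
  have bl k := bf (lshift n.+1 (rev_ord k)); have br k := bf (rshift n.+1 k).
  split; apply/forallP => k; move: (bl k) (br k); rewrite left_ok right_ok;
    by case/andP=> ? ? /andP[? ?]; try apply/andP.
rewrite -(splitK p); case: (split p) => k /=.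
  have := left_ok (rev_ord k); rewrite lf /left_factor rev_ordK => ->.
  by have := bf (rev_ord k); rewrite /left_factor rev_ordK => /andP[].
have := right_ok k; rewrite rf => ->.
by have /andP[] := bf k.
Qed.

(** [x_to_y] as a ring morphism, so that it can be applied to coefficients by [ma_map]. *)
Definition x_to_y_morph : {rmorphism polyxy -> polyxy} :=
  comp_mpoly [tuple match split k with
                    | inl l => 'X_(yvar l)
                    | inr l => 'X_(yvar l)
                    end | k < n.+1 + n.+1].

Lemma x_to_y_morphE f : x_to_y_morph f = x_to_y f.
Proof. by []. Qed.

Lemma x_to_y_x k : x_to_y (X k) = Y k.
Proof. by rewrite /x_to_y comp_mpolyXU -tnth_nth tnth_mktuple split_lshift. Qed.

(** Cut [groth_gen] at its center. By [ma_rev] the coefficient of [u] in the increasing half is that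
    of the inverse of [u] in the decreasing product in the y variables, a single Grothendieck
    polynomial. *)
Lemma double_groth_pairs (w : 'S_n.+1) :
  double_groth w = \sum_(p in hecke_pairs w)
    x_to_y (single_groth (p.1^-1)%g) * single_groth p.2.
Proof.
rewrite double_grothE /groth_gen ma_mulE; apply: eq_big => [p | p _].
  by rewrite hecke_pairsE.
rewrite !single_grothE; congr (_ * _).
rewrite -ma_rev_decprod ffunE -x_to_y_morphE -ma_mapE map_decprod.
rewrite [in RHS](@eq_decprod _ _ _ n 0 _ (ext (fun k => Y k))) // => k.
rewrite comp_ext /ext; case: insub => //= l.
by rewrite x_to_y_morphE x_to_y_x.
Qed.
End Monomials.

Theorem theorem3p6 (n : nat) (w : 'S_n.+1) :
  [/\ double_groth w =
        \sum_(f in bounded_circled w) xymonomial (cxwt f) (cywt f),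
      double_groth w =
        \sum_(f in bounded_double w) xymonomial (dxwt f) (dywt f)
    & double_groth w =
        \sum_(p in hecke_pairs w)
          x_to_y (single_groth (p.1^-1)%g) * single_groth p.2].
Proof.
split; [exact: double_groth_circled | exact: double_groth_double |].
exact: double_groth_pairs.
Qed.
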